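(* Let $D$ be a $2$-dimensional regular local ring with maximal ideal $\mathfrak{m}_D=(x,y)D$ and with an algebraically closed coefficient field $k$. Let $$A=D\Big[\Big\{\tfrac{y^2}{x+ay}: a\in k\Big\}\cup\Big\{\tfrac{x^2}{y}\Big\}\Big],\quad \mathfrak{m}=\Big(x,y,\Big\{\tfrac{y^2}{x+ay}: a\in k\Big\}\cup\Big\{\tfrac{x^2}{y}\Big\}\Big)A,\quad C=A_{\mathfrak{m}}.$$ For $a\in k$ let $\alpha_a=D[\frac{x+ay}{y}]_{(y,\frac{x+ay}{y})}$, $\beta_a=\alpha_a[\frac{y^2}{x+ay}]_{(\frac{x+ay}{y},\frac{y^2}{x+ay})}$, and let $\alpha'=D[\frac{y}{x}]_{(x,\frac{y}{x})}$, $\beta'=\alpha'[\frac{x^2}{y}]_{(\frac{y}{x},\frac{x^2}{y})}$ (localizations at the ideals generated by the indicated elements). Then $C=\bigcap_{a\in k}\beta_a\cap\beta'$, and $C$ is a non-Noetherian local domain which is an intersection of rings in $Q(D)$.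
   Context: A coefficient field of $D$ is a subfield $k\subseteq D$ mapping isomorphically onto $D/\mathfrak{m}_D$. $Q(D)$ denotes the set of all $2$-dimensional regular local rings $\alpha$ with $D\subseteq\alpha\subseteq F$, where $F$ is the quotient field of $D$. *)

(* Defs.v *)
(* Subrings of a field F are represented as predicates F -> Prop. *)
From HB Require Import structures.
From mathcomp Require Import all_boot all_order all_algebra.
Set Implicit Arguments. Unset Strict Implicit. Unset Printing Implicit Defensive.
Import Order.TTheory GRing.Theory Num.Theory.
Local Open Scope ring_scope.

Section Defs.
Variable F : fieldType.

Definition subring (R : F -> Prop) : Prop :=
  R 0 /\ R 1 /\ (forall a b, R a -> R b -> R (a - b)) /\
  (forall a b, R a -> R b -> R (a * b)).

Definition ideal_of (R I : F -> Prop) : Prop :=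
  (forall a, I a -> R a) /\ I 0 /\ (forall a b, I a -> I b -> I (a + b)) /\
  (forall r a, R r -> I a -> I (r * a)).

Definition gen_ideal (R T : F -> Prop) : F -> Prop :=
  fun z => forall I, ideal_of R I -> (forall t, T t -> I t) -> I z.

Definition gen_ring (R T : F -> Prop) : F -> Prop :=
  fun z => forall S, subring S -> (forall r, R r -> S r) -> (forall t, T t -> S t) -> S z.

Definition localization (R P : F -> Prop) : F -> Prop :=
  fun z => exists a b, R a /\ R b /\ ~ P b /\ z = a / b.

Definition nonunits (R : F -> Prop) : F -> Prop :=
  fun a => R a /\ ~ (exists b, R b /\ a * b = 1).

Definition local_ring (R : F -> Prop) : Prop :=
  subring R /\ ideal_of R (nonunits R).

Definition prime_ideal (R P : F -> Prop) : Prop :=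
  ideal_of R P /\ ~ P 1 /\
  (forall a b, R a -> R b -> P (a * b) -> P a \/ P b).

Definition noetherian (R : F -> Prop) : Prop :=
  forall I, ideal_of R I -> exists s : seq F,
    (forall t, t \in s -> R t) /\ (forall z, I z <-> gen_ideal R (fun t => t \in s) z).

Definition krull_dim_ge (R : F -> Prop) (n : nat) : Prop :=
  exists P : nat -> F -> Prop,
    (forall i, (i <= n)%N -> prime_ideal R (P i)) /\
    (forall i, (i < n)%N -> (forall z, P i z -> P i.+1 z) /\ exists z, P i.+1 z /\ ~ P i z).

Definition krull_dim_eq (R : F -> Prop) (n : nat) : Prop :=
  krull_dim_ge R n /\ ~ krull_dim_ge R n.+1.

Definition regular_local2 (R : F -> Prop) : Prop :=
  local_ring R /\ noetherian R /\ krull_dim_eq R 2 /\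
  exists u v, R u /\ R v /\
    (forall z, nonunits R z <-> gen_ideal R (fun t => t = u \/ t = v) z).

Definition quotient_field_is (R : F -> Prop) : Prop :=
  forall z, exists a b, R a /\ R b /\ b != 0 /\ z = a / b.

Definition subfield (K : F -> Prop) : Prop :=
  subring K /\ (forall a, K a -> a != 0 -> K a^-1).

(* k is a coefficient field of the local ring D: k subset D and the composite
   k -> D -> D/m_D is bijective *)
Definition coefficient_field (D K : F -> Prop) : Prop :=
  subfield K /\ (forall c, K c -> D c) /\
  (forall d, D d -> exists c, K c /\ nonunits D (d - c)) /\
  (forall c, K c -> nonunits D c -> c = 0).

Definition alg_closed_subfield (K : F -> Prop) : Prop :=
  forall p : {poly F}, (forall i, K p`_i) -> (1 < size p)%N ->
    exists c, K c /\ root p c.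

Definition inQ (D alpha : F -> Prop) : Prop :=
  regular_local2 alpha /\ (forall d, D d -> alpha d).

Definition gensA (k : F -> Prop) (x y : F) : F -> Prop :=
  fun z => (exists a, k a /\ z = y ^+ 2 / (x + a * y)) \/ z = x ^+ 2 / y.

Definition ringA (D k : F -> Prop) (x y : F) := gen_ring D (gensA k x y).

Definition idealmA (D k : F -> Prop) (x y : F) :=
  gen_ideal (ringA D k x y) (fun z => z = x \/ z = y \/ gensA k x y z).

Definition ringC (D k : F -> Prop) (x y : F) :=
  localization (ringA D k x y) (idealmA D k x y).

Definition adj_loc (R : F -> Prop) (t u v : F) : F -> Prop :=
  let S := gen_ring R (fun z => z = t) in
  localization S (gen_ideal S (fun z => z = u \/ z = v)).

Definition alpha_a (D : F -> Prop) (x y a : F) :=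
  adj_loc D ((x + a * y) / y) y ((x + a * y) / y).

Definition beta_a (D : F -> Prop) (x y a : F) :=
  adj_loc (alpha_a D x y a) (y ^+ 2 / (x + a * y)) ((x + a * y) / y) (y ^+ 2 / (x + a * y)).

Definition alpha' (D : F -> Prop) (x y : F) :=
  adj_loc D (y / x) x (y / x).

Definition beta' (D : F -> Prop) (x y : F) :=
  adj_loc (alpha' D x y) (x ^+ 2 / y) (y / x) (x ^+ 2 / y).

End Defs.

(* Main.v *)
From Stdlib Require Import Classical.
From mathcomp Require Import all_boot all_order all_algebra.
From mathcomp Require Import ring zify.
Require Import Defs.
Set Implicit Arguments. Unset Strict Implicit. Unset Printing Implicit Defensive.
Import GRing.Theory.
Local Open Scope ring_scope.

(* Blowing up m_D and then every closed point of the exceptional line E = P^1_k, the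
   rings beta_a and beta' are the local rings at the points of the strict
   transform of E.  At the point X = 0 of E, where X = x + a y, Y = y (or X = y, Y = x),
   such a ring has parameters s = Y^2 / X (defining E) and t = X / Y (defining the new
   curve), so that Y = s t and X = s t^2.

   If z lies in all these rings, its ideal of denominators in D is principal, say gD,
   and g is a unit times a monomial in s, t at every point of E.  Let G be the initial
   form of g; as k is algebraically closed, G is a product of linear forms.  Then
   g / G is a unit at every point, and both g / G and (g z) / G lie in A: expanding a
   numerator by initial forms, regularity at the points of E bounds the pole orders of
   the successive quotients of forms by their degrees, and partial fractions write
   these in terms of the generators y^2 / (x + a y) and x^2 / y.

   Every finite subset of the maximal ideal of C is contained in y alpha_a for all but
   finitely many a, whereas y^2 / (x + a y) is not in y beta_a; so C is not
   Noetherian.  Regularity of quadratic transforms follows from Hilbert's basis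
   theorem and the criterion: a Noetherian local domain with maximal ideal (X, Y) is
   2-dimensional iff X <> 0 and no power of Y lies in (X). *)

(** * Ideals of subrings of a field *)

Section Ideals.
Variable F : fieldType.
Implicit Types (R S I J K P T : F -> Prop) (a b c u v x y z : F).

Section Subring.
Variables (R : F -> Prop) (sR : subring R).

Lemma subring0 : R 0. Proof. by case: sR. Qed.
Lemma subring1 : R 1. Proof. by case: sR => _ []. Qed.
Lemma subringB a b : R a -> R b -> R (a - b).
Proof. by case: sR => _ [_ [h _]]; apply: h. Qed.
Lemma subringM a b : R a -> R b -> R (a * b).
Proof. by case: sR => _ [_ [_ h]]; apply: h. Qed.
Lemma subringN a : R a -> R (- a).
Proof. by move=> Ra; rewrite -sub0r; apply: subringB => //; apply: subring0. Qed.
Lemma subringD a b : R a -> R b -> R (a + b).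
Proof. by move=> Ra Rb; rewrite -[b]opprK; apply: subringB => //; apply: subringN. Qed.
Lemma subringX a n : R a -> R (a ^+ n).
Proof.
move=> Ra; elim: n => [|n IH]; first exact: subring1.
by rewrite exprS; apply: subringM.
Qed.
Lemma subring_sum (n : nat) (f : 'I_n -> F) :
  (forall i, R (f i)) -> R (\sum_(i < n) f i).
Proof. by move=> h; elim/big_ind: _ => //; [apply: subring0 | apply: subringD]. Qed.

Lemma subring_ideal : ideal_of R R.
Proof.
split=> //; split; first exact: subring0.
by split; [apply: subringD | apply: subringM].
Qed.

End Subring.

Section Ideal.
Variables (R I : F -> Prop) (sR : subring R) (idI : ideal_of R I).

Lemma ideal_sub a : I a -> R a. Proof. by case: idI => h _; apply: h. Qed.
Lemma ideal0 : I 0. Proof. by case: idI => _ []. Qed.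
Lemma idealD a b : I a -> I b -> I (a + b).
Proof. by case: idI => _ [_ [h _]]; apply: h. Qed.
Lemma idealM r a : R r -> I a -> I (r * a).
Proof. by case: idI => _ [_ [_ h]]; apply: h. Qed.
Lemma idealMr r a : R r -> I a -> I (a * r).
Proof. by move=> Rr Ia; rewrite mulrC; apply: idealM. Qed.
Lemma idealN a : I a -> I (- a).
Proof.
by move=> Ia; rewrite -mulN1r; apply: idealM => //; apply: (subringN sR); apply: subring1.
Qed.
Lemma idealB a b : I a -> I b -> I (a - b).
Proof. by move=> Ia Ib; apply: idealD => //; apply: idealN. Qed.

End Ideal.

Definition multiples R x : F -> Prop := fun z => exists2 a, R a & z = a * x.

Lemma multiples_ideal R x : subring R -> R x -> ideal_of R (multiples R x).
Proof.
move=> sR Rx; split; first by move=> _ [a Ra ->]; apply: subringM.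
split; first by exists 0; [apply: subring0 | rewrite mul0r].
split=> [_ _ [a Ra ->] [b Rb ->]|r _ Rr [a Ra ->]].
  by exists (a + b); [apply: subringD | rewrite mulrDl].
by exists (r * a); [apply: subringM | rewrite mulrA].
Qed.

Lemma zero_ideal R : subring R -> ideal_of R (fun z => z = 0).
Proof.
move=> sR; split; first by move=> _ ->; apply: subring0.
by do 2![split=> //]; [move=> _ _ -> ->; rewrite addr0 | move=> r _ _ ->; rewrite mulr0].
Qed.

Lemma gen_ideal_inc R T t : T t -> gen_ideal R T t.
Proof. by move=> Tt I _; apply. Qed.

Lemma gen_ideal_ideal R T : subring R -> (forall t, T t -> R t) ->
  ideal_of R (gen_ideal R T).
Proof.
move=> sR TR; split; first by move=> a; apply=> //; apply: subring_ideal.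
split; first by move=> I idI _; apply: ideal0 idI.
split=> [a b Ha Hb I idI TI|r a Rr Ha I idI TI].
  by apply: (idealD idI); [apply: Ha | apply: Hb].
by apply: (idealM idI) => //; apply: Ha.
Qed.

Lemma gen_ideal_pair R u v z : subring R -> R u -> R v ->
  gen_ideal R (fun t => t = u \/ t = v) z <->
  exists a b, [/\ R a, R b & z = a * u + b * v].
Proof.
move=> sR Ru Rv; have R0 := subring0 sR; have R1 := subring1 sR.
split=> [Hz|[a [b [Ra Rb ->]]] I idI TI].
  pattern z; apply: Hz.
    split; first by move=> _ [a [b [Ra Rb ->]]]; apply: subringD => //; apply: subringM.
    split; first by exists 0, 0; split=> //; ring.
    split=> [_ _ [a [b [Ra Rb ->]]] [a' [b' [Ra' Rb' ->]]]|r _ Rr [a [b [Ra Rb ->]]]].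
      by exists (a + a'), (b + b'); split; [apply: subringD|apply: subringD|ring].
    by exists (r * a), (r * b); split; [apply: subringM|apply: subringM|ring].
  by move=> t [] ->; [exists 1, 0 | exists 0, 1]; split=> //; ring.
by apply: (idealD idI); apply: (idealM idI) => //; apply: TI; [left|right].
Qed.

Lemma gen_ring_subring R T : subring (gen_ring R T).
Proof.
split; first by move=> S sS _ _; apply: subring0.
split; first by move=> S sS _ _; apply: subring1.
split=> a b Ha Hb S sS RS TS.
  by apply: subringB => //; [apply: Ha | apply: Hb].
by apply: subringM => //; [apply: Ha | apply: Hb].
Qed.

Lemma gen_ring_base R T r : R r -> gen_ring R T r.
Proof. by move=> Rr S _ RS _; apply: RS. Qed.

Lemma gen_ring_inc R T t : T t -> gen_ring R T t.
Proof. by move=> Tt S _ _; apply. Qed.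

Definition unit_in R u := [/\ u != 0, R u & R u^-1].

Lemma unit_in1 R : subring R -> unit_in R 1.
Proof. by move=> sR; split; rewrite ?invr1 ?oner_eq0 //; apply: subring1. Qed.

Lemma unit_inM R u v : subring R -> unit_in R u -> unit_in R v -> unit_in R (u * v).
Proof.
move=> sR [u0 Ru Ru'] [v0 Rv Rv']; split; first by rewrite mulf_neq0.
  exact: subringM.
by rewrite invfM; apply: subringM.
Qed.

Lemma unit_inV R u : unit_in R u -> unit_in R u^-1.
Proof. by case=> u0 Ru Ru'; split; rewrite ?invrK ?invr_eq0. Qed.

Lemma unit_or_nonunit R a : R a -> unit_in R a \/ nonunits R a.
Proof.
move=> Ra; have [[b [Rb ab]]|] := classic (exists b, R b /\ a * b = 1); last by right.
have a0 : a != 0 by apply: contra_eq_neq ab => ->; rewrite mul0r eq_sym oner_eq0.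
by left; split=> //; rewrite -[a^-1]mulr1 -ab mulKf.
Qed.

Lemma unit_notin_nonunits R a : unit_in R a -> ~ nonunits R a.
Proof. by case=> a0 _ Ra' [_]; apply; exists a^-1; rewrite mulfV. Qed.

Lemma unit_in_add_nonunit R u z : local_ring R -> unit_in R u -> nonunits R z ->
  unit_in R (u + z).
Proof.
move=> [sR idm] Uu Nz; have [_ Ru _] := Uu.
have [//|Nuz] : unit_in R (u + z) \/ nonunits R (u + z).
  by apply: unit_or_nonunit; apply: subringD => //; case: Nz.
case: (unit_notin_nonunits Uu); rewrite -[u](addrK z).
exact: (idealB sR idm).
Qed.

(** The generators of K are removed one at a time. Modulo J and the remaining generators, [a] is
    [x * w] for some [w] in K, and [w] is [r * a]; so [(1 - x * r) * a] vanishes there, and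
    [1 - x * r] is a unit. *)
Lemma nakayama R K J x : local_ring R -> noetherian R ->
  ideal_of R K -> ideal_of R J -> nonunits R x ->
  (forall z, K z -> exists2 w, K w & J (z - x * w)) ->
  forall z, K z -> J z.
Proof.
move=> lR nR idK idJ Nx step; have [sR idm] := lR; have [Rx _] := Nx.
have [s [sRs sK]] := nR _ idK.
have {sRs}: forall t, t \in s -> K t by move=> t ts; apply/sK; apply: gen_ideal_inc.
(* Generation is weakened to generation modulo J, the invariant of the induction on [s]. *)
have {sK}: forall z, K z -> gen_ideal R (fun t => J t \/ t \in s) z.
  move=> z /sK Hz I idI TI; apply: Hz => // t ts; apply: TI; by right.
elim: s => [|a s IH] gK sK.
  by move=> z /gK Hz; apply: Hz => // t [].
have idJs : ideal_of R (gen_ideal R (fun t => J t \/ t \in s)).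
  apply: gen_ideal_ideal => // t [/(ideal_sub idJ)//|ts].
  by apply: (ideal_sub idK); apply: sK; rewrite inE ts orbT.
set J' := gen_ideal _ _ in idJs.
have JJ' z : J z -> J' z by move=> Jz; apply: gen_ideal_inc; left.
have dec z : K z -> exists2 r, R r & J' (z - r * a).
  move=> /gK Hz; pattern z; apply: Hz.
    split=> [w [r Rr]|]; last split.
    - move=> /(ideal_sub idJs) Rw; rewrite -[w](subrK (r * a)).
      apply: subringD => //; apply: subringM => //; apply: (ideal_sub idK); apply: sK.
      by rewrite mem_head.
    - by exists 0; [apply: subring0 | rewrite mul0r subr0; apply: ideal0 idJs].
    split=> [b c [r Rr Hb] [r' Rr' Hc]|q b Rq [r Rr Hb]].
      exists (r + r'); first exact: subringD.
      have -> : b + c - (r + r') * a = (b - r * a) + (c - r' * a) by ring.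
      exact: (idealD idJs).
    exists (q * r); first exact: subringM.
    have -> : q * b - q * r * a = q * (b - r * a) by ring.
    exact: (idealM idJs).
  move=> t [Jt|]; first by exists 0; [apply: subring0 | rewrite mul0r subr0; apply: JJ'].
  rewrite inE => /predU1P[->|ts].
    by exists 1; [apply: subring1 | rewrite mul1r subrr; apply: ideal0 idJs].
  exists 0; first exact: subring0.
  by rewrite mul0r subr0; apply: gen_ideal_inc; right.
have Ka : K a by apply: sK; rewrite mem_head.
have J'a : J' a.
  have [w Kw Jw] := step _ Ka; have [r Rr Jr] := dec _ Kw.
  have [U0 _ U1] : unit_in R (1 + x * (- r)).
    apply: unit_in_add_nonunit => //; first exact: unit_in1.
    by apply: (idealMr idm) => //; apply: subringN.
  have -> : a = (1 + x * (- r))^-1 * ((a - x * w) + x * (w - r * a)) by field.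
  by apply: (idealM idJs) => //; apply: (idealD idJs); [apply: JJ' | apply: (idealM idJs)].
apply: IH => [z /dec[r Rr Jr]|t ts]; last by apply: sK; rewrite inE ts orbT.
by rewrite -/J' -[z](subrK (r * a)); apply: (idealD idJs) => //; apply: (idealM idJs).
Qed.

Lemma ideal_chain_stabilizes R (I : nat -> F -> Prop) : noetherian R ->
  (forall n, ideal_of R (I n)) -> (forall n z, I n z -> I n.+1 z) ->
  exists N, forall n z, I n z -> I N z.
Proof.
move=> nR idI inc.
have mono m n z : (m <= n)%N -> I m z -> I n z.
  move=> /subnK <-; elim: (n - m)%N => // p IH /IH; exact: inc.
have idU : ideal_of R (fun z => exists n, I n z).
  split; first by move=> z [n]; apply: ideal_sub (idI n) _.
  split; first by exists 0%N; apply: ideal0 (idI 0%N).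
  split=> [a b [n In] [m Im]|r a Rr [n In]]; last by exists n; apply: idealM (idI n) _ _ _ _.
  exists (maxn n m); apply: (idealD (idI _)); [apply: mono In|apply: mono Im].
    exact: leq_maxl.
  exact: leq_maxr.
have [s [_ sU]] := nR _ idU.
have {idU} : forall t, t \in s -> exists n, I n t by move=> t ts; apply/sU; apply: gen_ideal_inc.
move=> sI; have [N sN] : exists N, forall t, t \in s -> I N t.
  elim: s sI {sU} => [|a s IH] sI; first by exists 0%N.
  have [n In] := sI a (mem_head _ _).
  have [t ts|N sN] := IH; first by apply: sI; rewrite inE ts orbT.
  exists (maxn n N) => t; rewrite inE => /predU1P[->|/sN IN].
    by apply: mono In; apply: leq_maxl.
  by apply: mono IN; apply: leq_maxr.
exists N => n z Inz; have /sU : exists n, I n z by exists n.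
by apply=> //; apply: idI.
Qed.

(* With (I : y^N) = (I : y^n) for n >= N, the ideal K of those b for which b y^N lies
   in every I + (y^n) satisfies K <= yK + (I : y^N), and Nakayama applies. *)
Lemma krull_intersection R I y z : local_ring R -> noetherian R -> ideal_of R I ->
  nonunits R y ->
  (forall n, exists2 b, R b & I (z - b * y ^+ n)) -> I z.
Proof.
move=> lR nR idI Ny; have [sR idm] := lR; have [Ry _] := Ny.
have RX n : R (y ^+ n) by apply: subringX.
pose C n b := R b /\ I (b * y ^+ n).
have idC n : ideal_of R (C n).
  split; first by move=> b [].
  split; first by split; [apply: subring0 | rewrite mul0r; apply: ideal0 idI].
  split=> [a b [Ra Ia] [Rb Ib]|r a Rr [Ra Ia]]; split.
  - exact: subringD.
  - by rewrite mulrDl; apply: (idealD idI).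
  - exact: subringM.
  - by rewrite -mulrA; apply: (idealM idI).
have [N CN] : exists N, forall n b, C n b -> C N b.
  apply: (ideal_chain_stabilizes nR idC) => n b [Rb Ib]; split=> //.
  by rewrite exprS mulrCA; apply: (idealM idI).
pose J z := forall n, exists2 b, R b & I (z - b * y ^+ n).
have JD a b : J a -> J b -> J (a + b).
  move=> Ja Jb n; have [c Rc Ic] := Ja n; have [d Rd Id] := Jb n.
  exists (c + d); first exact: subringD.
  have -> : a + b - (c + d) * y ^+ n = (a - c * y ^+ n) + (b - d * y ^+ n) by ring.
  exact: (idealD idI).
have JM r a : R r -> J a -> J (r * a).
  move=> Rr Ja n; have [c Rc Ic] := Ja n.
  exists (r * c); first exact: subringM.
  have -> : r * a - r * c * y ^+ n = r * (a - c * y ^+ n) by ring.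
  exact: (idealM idI).
have IJ a : I a -> J a.
  by move=> Ia n; exists 0; [apply: subring0 | rewrite mul0r subr0].
pose K b := R b /\ J (b * y ^+ N).
have idK : ideal_of R K.
  split; first by move=> b [].
  split; first by split; [apply: subring0 | rewrite mul0r; apply: IJ; apply: ideal0 idI].
  split=> [a b [Ra Ia] [Rb Ib]|r a Rr [Ra Ia]]; split.
  - exact: subringD.
  - by rewrite mulrDl; apply: JD.
  - exact: subringM.
  - by rewrite -mulrA; apply: JM.
have KC b : K b -> C N b.
  apply: (nakayama lR nR idK (idC N) Ny) => {}b [Rb Jb].
  have [c Rc Ic] := Jb N.+1.
  have ryc : R (y * c) by apply: subringM.
  exists c; last first.
    split; first exact: subringB.
    by have -> : (b - y * c) * y ^+ N = b * y ^+ N - c * y ^+ N.+1 by rewrite exprS; ring.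
  (* Comparing the expansions of [b * y ^+ N] at the exponents N + 1 and n + N + 1 puts
     [c - e * y ^+ n] in (I : y^(N+1)), hence in (I : y^N) by the choice of N. So [c * y ^+ N] is a
     multiple of [y ^+ n] modulo I. *)
  split=> // n; have [e Re Ie] := Jb (n + N.+1)%N.
  have [_ IeN] : C N (c - e * y ^+ n).
    apply: (CN N.+1); split; first by apply: subringB => //; apply: subringM.
    have -> : (c - e * y ^+ n) * y ^+ N.+1 =
      (b * y ^+ N - e * y ^+ (n + N.+1)) - (b * y ^+ N - c * y ^+ N.+1).
      by rewrite exprD; ring.
    exact: (idealB sR idI).
  exists (e * y ^+ N); first exact: subringM.
  by have -> : c * y ^+ N - e * y ^+ N * y ^+ n = (c - e * y ^+ n) * y ^+ N by ring.
move=> Jz; have [b Rb Ib] := Jz N.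
have [_ IbN] : C N b.
  apply: KC; split=> //.
  have -> : b * y ^+ N = z + (- 1) * (z - b * y ^+ N) by ring.
  by apply: JD => //; apply: JM; [apply: (subringN sR); apply: subring1 | apply: IJ].
by rewrite -[z](subrK (b * y ^+ N)); apply: (idealD idI).
Qed.

End Ideals.

(** * Two-dimensional regular local rings *)

Lemma least_nat (P : nat -> Prop) : (exists n, P n) ->
  exists n, P n /\ forall m, P m -> (n <= m)%N.
Proof.
case=> n; elim/ltn_ind: n => n IH Pn.
have [[m [mn Pm]]|h] := classic (exists m, (m < n)%N /\ P m); first exact: IH Pm.
by exists n; split=> // m Pm; rewrite leqNgt; apply/negP => mn; apply: h; exists m.
Qed.

Section RegularParameters.
Variable F : fieldType.
Implicit Types (R I J K P : F -> Prop) (a b c d f g u v z X Y : F).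

Record two_generated R X Y : Prop := TwoGenerated {
  tg_local : local_ring R;
  tg_noetherian : noetherian R;
  tg_fst : R X;
  tg_snd : R Y;
  tg_max : forall z, nonunits R z <-> exists a b, [/\ R a, R b & z = a * X + b * Y] }.

Lemma tg_subring R X Y : two_generated R X Y -> subring R.
Proof. by case=> -[]. Qed.

Lemma tg_swap R X Y : two_generated R X Y -> two_generated R Y X.
Proof.
case=> lR nR RX RY mR; split=> // z; split=> [/mR[a [b [Ra Rb ->]]]|[a [b [Ra Rb ->]]]].
  by exists b, a; rewrite addrC.
by apply/mR; exists b, a; rewrite addrC.
Qed.

Lemma tg_nonunit_fst R X Y : two_generated R X Y -> nonunits R X.
Proof.
move=> tg; apply/(tg_max tg); exists 1, 0; have sR := tg_subring tg.
by split; [apply: subring1 | apply: subring0 | ring].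
Qed.

Lemma tg_nonunit_snd R X Y : two_generated R X Y -> nonunits R Y.
Proof. by move/tg_swap/tg_nonunit_fst. Qed.

(** In R/XR the maximal ideal is generated by Y, so Krull's intersection theorem makes every nonzero
    class a unit times a power of Y. *)
Lemma unit_power_mod R X Y z : two_generated R X Y -> R z ->
  multiples R X z \/ exists n a b, [/\ R a, unit_in R b & z = a * X + b * Y ^+ n].
Proof.
move=> tg Rz; have sR := tg_subring tg.
have [h|/not_all_ex_not[n]] :=
  classic (forall n, exists2 b, R b & multiples R X (z - b * Y ^+ n)).
  left; apply: krull_intersection (tg_local tg) (tg_noetherian tg) _ _ h.
    exact: (multiples_ideal sR (tg_fst tg)).
  exact: tg_nonunit_snd tg.
(* The induction finds the last exponent n for which z lies in XR + Y^n R. There the coefficient of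
   Y^n cannot lie in (X, Y), so it is a unit. *)
elim: n => [|n IH] Hn.
  case: Hn; exists z => //; exists 0; first exact: subring0.
  by rewrite expr0; ring.
have [[b Rb [a Ra E]]|/IH//] := classic (exists2 b, R b & multiples R X (z - b * Y ^+ n)).
have Ez : z = a * X + b * Y ^+ n by rewrite -E; ring.
right; have [Ub|] := unit_or_nonunit Rb; first by exists n, a, b.
move=> /(tg_max tg)[c [d [Rc Rd Eb]]]; case: Hn; exists d => //.
exists (a + c * Y ^+ n).
  by apply: subringD => //; apply: subringM => //; apply/(subringX sR)/(tg_snd tg).
by rewrite Ez Eb exprS; ring.
Qed.

(* The image of I in R/X, where every nonzero element is a unit times a power of
   Y, is principal; a generator f lifts, I = fR + XI, and Nakayama applies. *)
Lemma principal_of_saturated R X Y I : two_generated R X Y -> ideal_of R I ->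
  (forall e, R e -> I (X * e) -> I e) ->
  exists2 f, I f & forall z, I z -> multiples R f z.
Proof.
move=> tg idI sat; have sR := tg_subring tg.
have nak f : I f -> (forall z, I z -> exists2 d, R d & multiples R X (z - d * f)) ->
    forall z, I z -> multiples R f z.
  move=> If h; apply: (nakayama (tg_local tg) (tg_noetherian tg) idI _ (tg_nonunit_fst tg)).
    exact: (multiples_ideal sR (ideal_sub idI If)).
  move=> z Iz; have [d Rd [e Re E]] := h z Iz.
  exists e; last by exists d => //; rewrite mulrC -E; ring.
  apply: sat => //; rewrite mulrC -E; apply: (idealB sR idI) => //.
  exact: (idealM idI).
(* [Q n] says that some element of I has Y-order n modulo X; an element of least order generates the
   image of I in R/XR. *)
pose Q n := exists z a b, [/\ I z, R a, unit_in R b & z = a * X + b * Y ^+ n].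
have [/least_nat[n [[f [a [b [If Ra [b0 Rb Rb'] Ef]]]] nmin]]|noQ] := classic (exists n, Q n).
  exists f => //; apply: nak => // z Iz; have Rz := ideal_sub idI Iz.
  have [zX|[m [c [d [Rc Ud Ez]]]]] := unit_power_mod tg Rz.
    by exists 0; [apply: subring0 | rewrite mul0r subr0].
  have nm : (n <= m)%N by apply: nmin; exists z, c, d.
  have [_ Rd _] := Ud.
  have Re : R (d * Y ^+ (m - n) / b).
    by do 2![apply: subringM => //]; apply: subringX => //; apply: (tg_snd tg).
  exists (d * Y ^+ (m - n) / b) => //.
  exists (c - d * Y ^+ (m - n) / b * a); first by apply: subringB => //; apply: subringM.
  by rewrite Ez Ef -{1}(subnK nm) exprD; field.
(* Here I is contained in XR, and [nak] with generator 0 shows I = 0. *)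
exists 0; first exact: (ideal0 idI).
apply: nak; first exact: (ideal0 idI).
move=> z Iz; exists 0; first exact: subring0.
rewrite mul0r subr0; have [//|[m [c [d [Rc Ud Ez]]]]] := unit_power_mod tg (ideal_sub idI Iz).
by case: noQ; exists m, z, c, d.
Qed.

Lemma prime_idealX R P a n : subring R -> prime_ideal R P -> R a -> P (a ^+ n) -> P a.
Proof.
move=> sR [idP [P1 prP]] Ra; elim: n => [|n IH]; first by rewrite expr0.
by rewrite exprS => /(prP _ _ Ra (subringX sR n Ra))[].
Qed.

Lemma prime_sub_nonunits R P z : prime_ideal R P -> P z -> nonunits R z.
Proof.
move=> [idP [P1 _]] Pz; split; first exact: (ideal_sub idP Pz).
by case=> b [Rb E]; apply: P1; rewrite -E; apply: (idealMr idP).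
Qed.

Lemma maximal_sub_prime R X Y P : two_generated R X Y -> ideal_of R P -> P X -> P Y ->
  forall z, nonunits R z -> P z.
Proof.
move=> tg idP PX PY z /(tg_max tg)[a [b [Ra Rb ->]]].
by apply: (idealD idP); apply: (idealM idP).
Qed.

(** Suppose Y^n = aX. The middle prime of a chain of length two cannot contain X, since it would
    then contain Y and be maximal. So it is saturated with respect to X, hence principal, say fR
    with f = bX + cY. Modulo X, f^n is c^n Y^n, which is 0; so X divides f^n, against [noX]. *)
Lemma power_notin_multiples R X Y : two_generated R X Y -> krull_dim_ge R 2 ->
  forall n a, R a -> Y ^+ n <> a * X.
Proof.
move=> tg [C [primeC incC]] n a Ra E; have sR := tg_subring tg.
have RX := tg_fst tg; have RY := tg_snd tg.
have prP : prime_ideal R (C 1%N) by apply: primeC.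
have [idP [P1 Pmul]] := prP.
have [_ [p [Pp NP0p]]] := incC 0%N isT.
have [_ [q [P2q NPq]]] := incC 1%N isT.
have p0 : p != 0.
  apply/eqP => p0; apply: NP0p; rewrite p0.
  have [idP0 _] : prime_ideal R (C 0%N) by apply: primeC.
  exact: (ideal0 idP0).
have NX : ~ C 1%N X.
  move=> PX; apply: NPq; apply: (maximal_sub_prime tg idP PX).
    apply: (@prime_idealX R _ _ n) => //; rewrite E.
    exact: (idealM idP).
  by apply: (prime_sub_nonunits _ P2q); apply: primeC.
have [|f Pf genf] := @principal_of_saturated R X Y (C 1%N) tg idP.
  by move=> e Re /(Pmul _ _ RX Re)[].
have f0 : f != 0.
  by apply: contraNneq p0 => f0; have [b _ ->] := genf p Pp; rewrite f0 mulr0.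
(* As X lies outside the prime fR, an equation f^m = Xe forces f to divide e; cancelling f descends
   to 1 = Xe. *)
have noX : forall m e, R e -> f ^+ m <> X * e.
  elim=> [|m IH] e Re Ee.
    by have [_ []] := tg_nonunit_fst tg; exists e.
  have [//|/genf[e' Re' Ee']] : C 1%N X \/ C 1%N e.
    apply: Pmul => //; rewrite -Ee exprS; apply: (idealMr idP) => //.
    by apply: subringX => //; apply: (ideal_sub idP Pf).
  apply: (IH e') => //; apply: (mulIf f0); rewrite -exprSr Ee Ee'; ring.
have /(tg_max tg)[b [c [Rb Rc Ef]]] := prime_sub_nonunits prP Pf.
have [e Re Ee] : exists2 e, R e & f ^+ n = e * X + (c * Y) ^+ n.
  elim: (n) => [|m [e Re Ee]]; first by exists 0; [apply: subring0 | rewrite !expr0; ring].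
  exists (e * f + (c * Y) ^+ m * b).
    have Rf := ideal_sub idP Pf.
    by apply: subringD => //; apply: subringM => //; apply: subringX => //; apply: subringM.
  by rewrite !exprSr Ee Ef; ring.
apply: (noX n (e + c ^+ n * a)).
  by apply: subringD => //; apply: subringM => //; apply: subringX.
by rewrite Ee exprMn E; ring.
Qed.

(** An elementary form of dimension two that can be carried through quadratic transforms;
    [dim2_regular_params] and [reg_regular_local2] link it to Krull dimension. *)
Definition regular_params R X Y :=
  [/\ two_generated R X Y, X != 0 & forall n a, R a -> Y ^+ n <> a * X].

Lemma dim2_regular_params R X Y : two_generated R X Y -> krull_dim_ge R 2 ->
  regular_params R X Y.
Proof.
move=> tg dim2; have sR := tg_subring tg.
split=> //; last exact: power_notin_multiples.
apply/eqP => X0.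
apply: (power_notin_multiples (tg_swap tg) dim2 (n := 1) (subring0 sR)).
by rewrite X0 expr1 mul0r.
Qed.

Section Regular.
Variables (R : F -> Prop) (X Y : F) (reg : regular_params R X Y).

Lemma reg_two_generated : two_generated R X Y. Proof. by case: reg. Qed.
Lemma reg_local : local_ring R. Proof. by case: reg => -[]. Qed.
Lemma reg_subring : subring R. Proof. by case: reg => -[[]]. Qed.
Lemma reg_fst : R X. Proof. by case: reg => -[]. Qed.
Lemma reg_snd : R Y. Proof. by case: reg => -[]. Qed.
Lemma reg_fst_neq0 : X != 0. Proof. by case: reg. Qed.
Lemma reg_power_notin n a : R a -> Y ^+ n <> a * X. Proof. by case: reg => _ _; apply. Qed.
Lemma reg_nonunit_fst : nonunits R X. Proof. by case: reg => /tg_nonunit_fst. Qed.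
Lemma reg_nonunit_snd : nonunits R Y. Proof. by case: reg => /tg_nonunit_snd. Qed.

Let tg := reg_two_generated.
Let sR := reg_subring.
Let RX := reg_fst.
Let RY := reg_snd.
Let X0 := reg_fst_neq0.

Lemma unit_power_notin u n a : unit_in R u -> R a -> u * Y ^+ n <> a * X.
Proof.
move=> [u0 _ Ru'] Ra E; apply: (@reg_power_notin n (a / u)); first exact: subringM.
by apply: (mulfI u0); rewrite E; field.
Qed.

(** If X divided neither factor, both would be units times powers of Y modulo X, and so would their
    product. *)
Lemma reg_fst_prime a b : R a -> R b -> multiples R X (a * b) ->
  multiples R X a \/ multiples R X b.
Proof.
move=> Ra Rb [c Rc E].
have [|[n [a1 [a2 [Ra1 Ua2 Ea]]]]] := unit_power_mod tg Ra; first by left.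
have [|[m [b1 [b2 [Rb1 Ub2 Eb]]]]] := unit_power_mod tg Rb; first by right.
have [[_ Ra2 _] [_ Rb2 _]] := (Ua2, Ub2).
case: (@unit_power_notin (a2 * b2) (n + m) (c - a1 * b - a2 * Y ^+ n * b1)).
- exact: unit_inM.
- have Rn : R (Y ^+ n) by apply: subringX.
  by apply: (subringB sR); [apply: (subringB sR) => //|]; do ?[apply: (subringM sR) => //].
have -> : (c - a1 * b - a2 * Y ^+ n * b1) * X = c * X - a1 * X * b - a2 * Y ^+ n * (b1 * X) by ring.
by rewrite -E exprD Ea Eb; ring.
Qed.

(** If X^(n+1) = aY, the prime X divides a, since it does not divide Y; cancelling X descends to 1 =
    aY. *)
Lemma reg_swap : regular_params R Y X.
Proof.
have Y0 : Y != 0.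
  apply/eqP => Y0; apply: (@reg_power_notin 1 0); first exact: subring0.
  by rewrite Y0 mul0r expr1.
split=> //; first exact: tg_swap.
elim=> [|n IH] a Ra E.
  have [_ []] := reg_nonunit_snd; exists a; split=> //.
  by rewrite mulrC -E expr0.
have : multiples R X (a * Y).
  by rewrite -E exprSr; exists (X ^+ n) => //; apply: subringX.
move=> /(reg_fst_prime Ra RY)[[b Rb Eb]|[b Rb Eb]].
  apply: (IH b) => //; apply: (mulIf X0); rewrite -exprSr E Eb; ring.
by apply: (@reg_power_notin 1 b); rewrite ?expr1.
Qed.

(** The chain 0, XR, (X, Y) gives dimension at least two. In a chain C 0 < C 1 < C 2 < C 3 the prime
    C 2 is principal: without X it is saturated, and with X it equals XR, because any other element
    would put a power of Y, hence the maximal ideal, into C 2. If f generates C 2, then f is not in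
    C 1, so C 1 = f C 1 and Nakayama gives C 1 = 0. *)
Lemma reg_regular_local2 : regular_local2 R.
Proof.
have lR := reg_local; have [_ idm] := lR.
have nR := tg_noetherian tg.
split=> //; split=> //; split; last first.
  exists X, Y; split=> //; split=> // z; split.
    by move/(tg_max tg) => H; apply/(gen_ideal_pair _ sR RX RY).
  by move=> /(gen_ideal_pair _ sR RX RY) H; apply/(tg_max tg).
split.
  exists (fun i => match i with
    | 0%N => fun z => z = 0 | 1%N => multiples R X | _ => nonunits R end); split.
    case=> [|[|i]] _; split.
    - exact: zero_ideal.
    - split; first by apply/eqP; rewrite oner_eq0.
      by move=> a b _ _ /eqP; rewrite mulf_eq0 => /orP[]/eqP; [left|right].
    - exact: multiples_ideal.
    - split; last exact: reg_fst_prime.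
      move=> [a Ra E]; apply: (@reg_power_notin 0 a) => //; by rewrite expr0.
    - exact: idm.
    - split; first by case=> _ []; exists 1; rewrite mul1r; split=> //; apply: subring1.
      move=> a b Ra Rb Nab.
      have [Ua|] := unit_or_nonunit Ra; last by left.
      have [Ub|] := unit_or_nonunit Rb; last by right.
      by case: (unit_notin_nonunits (unit_inM sR Ua Ub)).
  case=> [|[|//]] _; split.
  - by move=> _ ->; exists 0; [apply: subring0 | rewrite mul0r].
  - exists X; split; first by exists 1; [apply: subring1 | rewrite mul1r].
    exact/eqP.
  - by move=> _ [a Ra ->]; apply: (idealM idm) => //; apply: reg_nonunit_fst.
  exists Y; split; first exact: reg_nonunit_snd.
  by move=> [a Ra E]; apply: (@reg_power_notin 1 a); rewrite ?expr1.
move=> [C [primeC incC]].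
have prP i : (i <= 3)%N -> prime_ideal R (C i) by apply: primeC.
have [id1 [N11 pr1]] := prP 1%N isT; have [id2 [N21 pr2]] := prP 2%N isT.
have [f C2f genf] : exists2 f, C 2%N f & forall z, C 2%N z -> multiples R f z.
  have [C2X|NC2X] := classic (C 2%N X); last first.
    by apply: (principal_of_saturated tg id2) => e Re /(pr2 _ _ RX Re)[].
  exists X => // z C2z.
  have [//|[n [a [b [Ra [b0 Rb Rb'] Ez]]]]] := unit_power_mod tg (ideal_sub id2 C2z).
  have [_ [w [C3w NC2w]]] := incC 2%N isT.
  case: NC2w; apply: (maximal_sub_prime tg id2 C2X).
    apply: (@prime_idealX R _ _ n) => //.
    have -> : Y ^+ n = b^-1 * (z - a * X) by rewrite Ez; field.
    by apply: (idealM id2) => //; apply: (idealB sR id2) => //; apply: (idealM id2).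
  by apply: (prime_sub_nonunits _ C3w); apply: prP.
have [_ [p [C1p NC0p]]] := incC 0%N isT.
have [C12 [q [C2q NC1q]]] := incC 1%N isT.
have NC1f : ~ C 1%N f.
  by move=> C1f; have [a Ra Eq] := genf q C2q; apply: NC1q; rewrite Eq; apply: (idealM id1).
have p0 : p = 0.
  apply: (nakayama lR nR id1 (zero_ideal sR) _ _ C1p (x := f)).
    by apply: (prime_sub_nonunits _ C2f); apply: prP.
  move=> z C1z; have [a Ra Ea] := genf z (C12 z C1z).
  exists a; last by rewrite Ea; ring.
  have [//|//] : C 1%N a \/ C 1%N f.
  by apply: pr1; rewrite -?Ea //; apply: (ideal_sub id2 C2f).
apply: NC0p; rewrite p0.
by have [id0 _] := prP 0%N isT; apply: (ideal0 id0).
Qed.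

Lemma reg_fst_adic d : R d -> d != 0 ->
  exists n e, [/\ R e, d = e * X ^+ n & ~ multiples R X e].
Proof.
move=> Rd d0; have [h|/not_all_ex_not[n]] :=
  classic (forall n, exists2 b, R b & d - b * X ^+ n = 0).
  case/eqP: d0; 
  exact: krull_intersection reg_local (tg_noetherian tg) (zero_ideal sR) reg_nonunit_fst h.
elim: n => [|n IH] Hn; first by case: Hn; exists d => //; rewrite expr0; ring.
have [[b Rb /eqP]|/IH//] := classic (exists2 b, R b & d - b * X ^+ n = 0).
rewrite subr_eq0 => /eqP E; exists n, b; split=> // -[c Rc Ec].
by apply: Hn; exists c => //; rewrite E Ec exprS; ring.
Qed.

(* Once the common powers of the prime X are removed, X is a nonzerodivisor modulo
   the ideal of denominators, so that [principal_of_saturated] applies. *)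
Lemma denominators_principal z : (exists d, [/\ R d, d != 0 & R (d * z)]) ->
  exists2 g, R g /\ R (g * z) & forall d, R d -> R (d * z) -> multiples R g d.
Proof.
case=> d [Rd d0 Rdz]; have [n [e [Re Ed Ne]]] := reg_fst_adic Rd d0.
elim: n z d {d0} Rd Rdz Ed => [|n IH] z d Rd Rdz.
  rewrite expr0 mulr1 => Ed; rewrite {}Ed {d} in Rd Rdz *.
  have [||g [Rg Rgz] h] := @principal_of_saturated R X Y (fun w => R w /\ R (w * z)) tg.
  - split; first by move=> a [].
    split; first by rewrite mul0r; split; apply: subring0.
    split=> [a b [Ra Ra'] [Rb Rb']|r a Rr [Ra Ra']]; split.
    + exact: subringD.
    + by rewrite mulrDl; apply: subringD.
    + exact: subringM.
    + by rewrite -mulrA; apply: subringM.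
  (* As [e * z] lies in R, X divides [X * w * z * e]; X is prime and does not divide [e], so it
     divides [X * w * z]. *)
  - move=> w Rw [_ RXwz]; split=> //.
    have : multiples R X (X * w * z * e).
      exists (w * (e * z)); first exact: subringM.
      by ring.
    move=> /(reg_fst_prime RXwz Re)[[c Rc Ec]|//].
    suff -> : w * z = c by [].
    by apply: (mulIf X0); rewrite -Ec; ring.
  by exists g => // d Rd' Rdz'; apply: h.
(* If X divides [d * z], it cancels and the exponent of X in the denominator drops. Otherwise X
   divides every denominator of z, and these are X times the denominators of [X * z]. *)
move=> Ed; have [[c Rc Ec]|NX] := classic (multiples R X (d * z)).
  apply: (IH z (e * X ^+ n)) => //; first by apply: subringM => //; apply: subringX.
  suff -> : e * X ^+ n * z = c by [].
  by apply: (mulIf X0); rewrite -Ec Ed exprSr; ring.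
have [||//|g [Rg Rgz] h] := IH (X * z) (e * X ^+ n).
- by apply: subringM => //; apply: subringX.
- by have -> : e * X ^+ n * (X * z) = d * z by rewrite Ed exprSr; ring.
exists (g * X); first by split; [apply: subringM | rewrite -mulrA].
move=> w Rw Rwz.
have [[c Rc Ec]|//] : multiples R X w \/ multiples R X (d * z).
  apply: reg_fst_prime => //; exists (w * z * (e * X ^+ n)).
    by apply: subringM => //; apply: subringM => //; apply: subringX.
  by rewrite Ed exprSr; ring.
have [|b Rb Eb] := h c Rc; first by rewrite mulrA -Ec.
by exists b => //; rewrite Ec Eb; ring.
Qed.

End Regular.

(** X and Y are both prime, by [reg_fst_prime] and [reg_swap]; they are divided out of [a] or [b]
    one at a time. *)
Lemma factor_of_monomial R X Y a b u i j : regular_params R X Y -> R a -> R b ->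
  unit_in R u -> a * b = u * X ^+ i * Y ^+ j ->
  exists v i' j', unit_in R v /\ a = v * X ^+ i' * Y ^+ j'.
Proof.
move=> reg; have sR := reg_subring reg.
move En : (i + j)%N => n; elim: n => [|n IH] in R X Y reg sR a b i j En *.
  move/eqP: En; rewrite addn_eq0 => /andP[/eqP-> /eqP->] Ra Rb [u0 Ru Ru'].
  rewrite !expr0 !mulr1 => E.
  have a0 : a != 0 by apply: contra_neq u0 => a0; rewrite -E a0 mul0r.
  exists a, 0%N, 0%N; rewrite !expr0 !mulr1; split=> //; split=> //.
  suff -> : a^-1 = b / u by apply: subringM.
  by apply: (mulfI a0); rewrite mulrA E mulfV // mulfV.
wlog i0 : i j X Y reg En / (0 < i)%N.
  move=> H Ra Rb Uu E; have [i0|] := posnP i; last by move=> i0; apply: (H i j X Y).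
  have [|||v [i' [j' [Uv Ea]]]] := H j i Y X (reg_swap reg) _ _ Ra Rb Uu.
  - by rewrite addnC.
  - by rewrite i0 add0n in En; rewrite En.
  - by rewrite E; ring.
  by exists v, j', i'; split=> //; rewrite Ea; ring.
case: i i0 En => // i _; rewrite addSn => -[En] Ra Rb Uu E; have [_ Ru _] := Uu.
have X0 := reg_fst_neq0 reg.
have [[c Rc Ec]|[c Rc Ec]] : multiples R X a \/ multiples R X b.
  apply: (reg_fst_prime reg) => //; rewrite E exprSr; exists (u * X ^+ i * Y ^+ j); last by ring.
    apply: (subringM sR); first apply: (subringM sR) => //.
      by apply: subringX => //; apply: (reg_fst reg).
    by apply: subringX => //; apply: (reg_snd reg).
  have [|v [i' [j' [Uv Ec']]]] := IH R X Y reg sR c b i j En Rc Rb Uu.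
    by apply: (mulIf X0); rewrite mulrAC -Ec E exprSr; ring.
  by exists v, i'.+1, j'; split=> //; rewrite Ec Ec' exprSr; ring.
apply: (IH R X Y reg sR a c i j) => //.
by apply: (mulIf X0); rewrite -[a * c * X]mulrA -Ec E exprSr; ring.
Qed.

End RegularParameters.

(** * Hilbert's basis theorem, localization, quadratic transforms *)

Section HilbertBasis.
Variable F : fieldType.
Implicit Types (R S I K P : F -> Prop) (p q : {poly F}).

Definition poly_in K p := forall i, K p`_i.

Lemma gen_ring1P R t z : subring R ->
  gen_ring R (fun w => w = t) z <-> exists2 p, poly_in R p & z = p.[t].
Proof.
move=> sR; split=> [Hz|[p Rp ->] S sS RS tS]; last first.
  rewrite horner_coef; apply: subring_sum => // i; apply: subringM => //; first exact: RS.
  by apply: subringX => //; apply: tS.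
pattern z; apply: Hz.
- split; first by exists 0; [move=> i; rewrite coef0; apply: subring0 | rewrite horner0].
  split.
    exists 1; last by rewrite hornerC.
    by move=> i; rewrite coef1; case: eqP => _; [apply: subring1 | apply: subring0].
  split=> _ _ [p Rp ->] [q Rq ->].
    by exists (p - q); [move=> i; rewrite coefB; apply: subringB | rewrite hornerD hornerN].
  exists (p * q); last by rewrite hornerM.
  by move=> i; rewrite coefM; apply: subring_sum => // j; apply: subringM.
- move=> r Rr; exists r%:P; last by rewrite hornerC.
  by move=> i; rewrite coefC; case: eqP => _ //; apply: subring0.
move=> _ ->; exists 'X; last by rewrite hornerX.
by move=> i; rewrite coefX; case: eqP => _; [apply: subring1 | apply: subring0].
Qed.

(** As [t] may satisfy relations over R, degrees are measured in R[T]: these are the coefficients of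
    T^n in the polynomials of degree at most n in the preimage of I under T -> t. *)
Definition leading_coefs R I t n : F -> Prop := fun c =>
  exists p, [/\ poly_in R p, (size p <= n.+1)%N, p`_n = c & I p.[t]].

Section LeadingCoefs.
Variables (R : F -> Prop) (t : F) (sR : subring R).
Let S := gen_ring R (fun w => w = t).

Lemma leading_coefs_ideal I n : ideal_of S I -> ideal_of R (leading_coefs R I t n).
Proof.
move=> idI; split; first by move=> _ [p [Rp _ <- _]].
split.
  exists 0; rewrite size_poly0 coef0 horner0; split=> //; last exact: (ideal0 idI).
  by move=> i; rewrite coef0; apply: subring0.
split=> [_ _ [p [Rp sp <- Ip]] [q [Rq sq <- Iq]]|r _ Rr [p [Rp sp <- Ip]]].
  exists (p + q); split; first by move=> i; rewrite coefD; apply: subringD.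
  - by apply: leq_trans (size_polyD _ _) _; rewrite geq_max sp.
  - by rewrite coefD.
  by rewrite hornerD; apply: (idealD idI).
exists (r *: p); split; first by move=> i; rewrite coefZ; apply: subringM.
- exact: leq_trans (size_scale_leq _ _) sp.
- by rewrite coefZ.
by rewrite hornerZ; apply: (idealM idI) => //; apply: gen_ring_base.
Qed.

Lemma leading_coefsS I n c : ideal_of S I ->
  leading_coefs R I t n c -> leading_coefs R I t n.+1 c.
Proof.
move=> idI [p [Rp sp <- Ip]]; exists (p * 'X); split.
- by move=> i; rewrite coefMX; case: eqP => _ //; apply: subring0.
- by apply/leq_sizeP => -[//|i]; rewrite ltnS => ni; rewrite coefMX /=; apply: (leq_sizeP _ _ sp).
- by rewrite coefMX.
by rewrite hornerMX; apply: (idealMr idI) => //; apply: gen_ring_inc.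
Qed.

Lemma leading_coefs_sub I J n c : (forall z, I z -> J z) ->
  leading_coefs R I t n c -> leading_coefs R J t n c.
Proof. by move=> IJ [p [Rp sp Ec Ip]]; exists p; split=> //; apply: IJ. Qed.

(** The ideals of leading coefficients stabilize at some N, and finitely many elements of I account
    for those of degree at most N; multiplication by T accounts for the higher ones. A polynomial
    with value in I is then lowered in size by subtracting one with the same top coefficient. *)
Lemma hilbert_basis : noetherian R -> noetherian S.
Proof.
move=> nR I idI.
have sS : subring S by apply: gen_ring_subring.
have idG (s : seq F) : (forall z, z \in s -> I z) -> ideal_of S (gen_ideal S (fun z => z \in s)).
  by move=> sI; apply: gen_ideal_ideal => // z /sI; apply: (ideal_sub idI).
have mono (s s' : seq F) : {subset s <= s'} ->
    forall z, gen_ideal S (fun z => z \in s) z -> gen_ideal S (fun z => z \in s') z.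
  by move=> ss' z Hz J idJ TJ; apply: Hz => // w /ss'; apply: TJ.
have lift n : exists s : seq F, (forall z, z \in s -> I z) /\
    forall c, leading_coefs R I t n c -> leading_coefs R (gen_ideal S (fun z => z \in s)) t n c.
  have [g [_ gL]] := nR _ (leading_coefs_ideal n idI).
  have: forall c, c \in g -> leading_coefs R I t n c.
    by move=> c cg; apply/gL; apply: gen_ideal_inc.
  move=> Lg.
  suff [s [sI sL]] : exists s : seq F, (forall z, z \in s -> I z) /\
      forall c, c \in g -> leading_coefs R (gen_ideal S (fun z => z \in s)) t n c.
    exists s; split=> // c /gL Hc; pattern c; apply: Hc => //.
    exact: (leading_coefs_ideal _ (idG _ sI)).
  elim: g Lg {gL} => [|c g IH] Lg; first by exists [::].
  have [d dg|s [sI sL]] := IH; first by apply: Lg; rewrite inE dg orbT.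
  have [p [Rp sp Ec Ip]] := Lg c (mem_head _ _).
  exists (p.[t] :: s); split; first by move=> z; rewrite inE => /predU1P[->|/sI].
  move=> d; rewrite inE => /predU1P[->|/sL].
    by exists p; split=> //; apply: gen_ideal_inc; rewrite mem_head.
  by apply: leading_coefs_sub; apply: mono => z zs; rewrite inE zs orbT.
have [N LN] := ideal_chain_stabilizes nR (fun n => leading_coefs_ideal n idI)
  (fun n c => @leading_coefsS I n c idI).
have [s [sI sL]] : exists s : seq F, (forall z, z \in s -> I z) /\ forall n, (n <= N)%N ->
    forall c, leading_coefs R I t n c -> leading_coefs R (gen_ideal S (fun z => z \in s)) t n c.
  elim: (N) => [|M [s [sI sL]]].
    by have [s [sI sL]] := lift 0%N; exists s; split=> // n; rewrite leqn0 => /eqP->.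
  have [s' [sI' sL']] := lift M.+1; exists (s ++ s'); split.
    by move=> z; rewrite mem_cat => /orP[/sI|/sI'].
  move=> n; rewrite leq_eqVlt => /orP[/eqP->|nM] c.
    by move/sL'; apply: leading_coefs_sub; apply: mono => z zs; rewrite mem_cat zs orbT.
  by move/(sL n nM); apply: leading_coefs_sub; apply: mono => z zs; rewrite mem_cat zs.
have {sL LN} sL n c : leading_coefs R I t n c ->
    leading_coefs R (gen_ideal S (fun z => z \in s)) t n c.
  have [nN|Nn] := leqP n N; first exact: sL.
  move/LN/(sL _ (leqnn _)); rewrite -(subnK (ltnW Nn)).
  by elim: (n - N)%N => // m IH /IH; rewrite addSn; apply: (leading_coefsS (idG _ sI)).
exists s; split; first by move=> z /sI; apply: (ideal_sub idI).
move=> z; split; last by move=> Hz; apply: Hz.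
move=> Iz; have /(gen_ring1P _ _ sR)[p Rp Ez] := ideal_sub idI Iz.
rewrite {z}Ez in Iz *; move: (leqnn (size p)); move: {2}(size p) => n.
elim: n p Rp Iz => [|n IH] p Rp Ip sp.
  move: sp; rewrite leqn0 size_poly_eq0 => /eqP->; rewrite horner0.
  exact: (ideal0 (idG _ sI)).
have [q [Rq sq Eq Iq]] : leading_coefs R (gen_ideal S (fun z => z \in s)) t n p`_n.
  by apply: sL; exists p.
have GI z : gen_ideal S (fun z => z \in s) z -> I z by move=> Hz; apply: Hz.
have -> : p.[t] = (p - q).[t] + q.[t] by rewrite hornerD hornerN subrK.
apply: (idealD (idG _ sI)) => //; apply: IH.
- by move=> i; rewrite coefB; apply: subringB.
- by rewrite hornerD hornerN; apply: (idealB sS idI) => //; apply: GI.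
apply/leq_sizeP => i; rewrite leq_eqVlt => /orP[/eqP<-|ni]; first by rewrite coefB Eq subrr.
by rewrite coefB (leq_sizeP _ _ sp) // (leq_sizeP _ _ sq) // subrr.
Qed.

End LeadingCoefs.
End HilbertBasis.

Section Localization.
Variables (F : fieldType) (S P : F -> Prop).
Hypotheses (sS : subring S) (idP : ideal_of S P) (P1 : ~ P 1).
Hypothesis maxP : forall a, S a -> P a \/ exists2 b, S b & P (1 - a * b).
Let L := localization S P.

(** Maximality is given as invertibility modulo [P] of everything outside [P]; primeness is derived
    from it here. *)
Lemma notin_max_mul a b : S a -> S b -> ~ P a -> ~ P b -> ~ P (a * b).
Proof.
move=> Sa Sb Na Nb Pab; have [//|[c Sc Pc]] := maxP Sa.
apply: Nb; have -> : b = b * (1 - a * c) + c * (a * b) by ring.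
by apply: (idealD idP); apply: (idealM idP).
Qed.

Lemma notin_max_neq0 b : ~ P b -> b != 0.
Proof. by move=> Nb; apply/eqP => b0; apply: Nb; rewrite b0; apply: (ideal0 idP). Qed.

Lemma localization_inc a : S a -> L a.
Proof.
by move=> Sa; exists a, 1; split=> //; split; [apply: subring1 | rewrite invr1 mulr1].
Qed.

Lemma localization_subring : subring L.
Proof.
split; first by apply: localization_inc; apply: subring0.
split; first by apply: localization_inc; apply: subring1.
split=> _ _ [a [b [Sa [Sb [Nb ->]]]]] [c [d [Sc [Sd [Nd ->]]]]];
  have b0 := notin_max_neq0 Nb; have d0 := notin_max_neq0 Nd;
  have Nbd := notin_max_mul Sb Sd Nb Nd.
  exists (a * d - c * b), (b * d); split; first by apply: subringB => //; apply: subringM.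
  by split; [apply: subringM | split=> //; field; rewrite b0 d0].
exists (a * c), (b * d); split; first exact: subringM.
by split; [apply: subringM | split=> //; field; rewrite b0 d0].
Qed.

Lemma unit_in_localization b : S b -> ~ P b -> unit_in L b.
Proof.
move=> Sb Nb; split; [exact: notin_max_neq0 | exact: localization_inc |].
by exists 1, b; split; [apply: subring1 | rewrite mul1r].
Qed.

Lemma nonunits_localization z :
  nonunits L z <-> exists a b, [/\ P a, S b, ~ P b & z = a / b].
Proof.
split=> [[[a [b [Sa [Sb [Nb Ez]]]]] Nz]|[a [b [Pa Sb Nb Ez]]]].
  exists a, b; split=> //; apply: NNPP => Na; apply: Nz.
  exists (b / a); split; first by exists b, a.
  by rewrite Ez; field; rewrite !notin_max_neq0.
have b0 := notin_max_neq0 Nb; have Sa := ideal_sub idP Pa.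
split; first by exists a, b.
case=> _ [[c [d [Sc [Sd [Nd ->]]]]] E]; have d0 := notin_max_neq0 Nd.
apply: (notin_max_mul Sb Sd Nb Nd).
suff -> : b * d = c * a by apply: (idealM idP).
by rewrite -[LHS]mul1r -E Ez; field; rewrite b0 d0.
Qed.

Lemma localization_local : local_ring L.
Proof.
have sL := localization_subring.
split=> //; split; first by move=> a [].
split.
  apply/nonunits_localization; exists 0, 1; rewrite mul0r.
  by split=> //; [apply: (ideal0 idP) | apply: subring1].
split=> [x y /nonunits_localization[a [b [Pa Sb Nb ->]]]
    /nonunits_localization[c [d [Pc Sd Nd ->]]]|
  _ x [r [q [Sr [Sq [Nq ->]]]]] /nonunits_localization[a [b [Pa Sb Nb ->]]]];
  apply/nonunits_localization.
  have b0 := notin_max_neq0 Nb; have d0 := notin_max_neq0 Nd.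
  exists (a * d + c * b), (b * d); split.
  - by apply: (idealD idP); apply: (idealMr idP).
  - exact: subringM.
  - exact: notin_max_mul.
  by field; rewrite b0 d0.
have b0 := notin_max_neq0 Nb; have q0 := notin_max_neq0 Nq.
exists (r * a), (q * b); split; first exact: (idealM idP).
- exact: subringM.
- exact: notin_max_mul.
by field; rewrite b0 q0.
Qed.

Lemma localization_noetherian : noetherian S -> noetherian L.
Proof.
move=> nS I idI; have sL := localization_subring.
have idJ : ideal_of S (fun z => S z /\ I z).
  split; first by move=> a [].
  split; first by split; [apply: subring0 | apply: (ideal0 idI)].
  split=> [a b [Sa Ia] [Sb Ib]|r a Sr [Sa Ia]]; split.
  - exact: subringD.
  - exact: (idealD idI).
  - exact: subringM.
  - by apply: (idealM idI) => //; apply: localization_inc.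
have [s [sSs sJ]] := nS _ idJ.
exists s; split; first by move=> t /sSs; apply: localization_inc.
move=> z; split=> [Iz|Hz]; last first.
  by apply: Hz => // t ts; have [] : S t /\ I t by apply/sJ; apply: gen_ideal_inc.
have [a [b [Sa [Sb [Nb Ez]]]]] := ideal_sub idI Iz; have b0 := notin_max_neq0 Nb.
have /sJ Ha : S a /\ I a.
  split=> //; have -> : a = b * z by rewrite Ez; field.
  by apply: (idealM idI) => //; apply: localization_inc.
move=> J idJ' sJ'; rewrite Ez mulrC; apply: (idealM idJ').
  by case: (unit_in_localization Sb Nb).
suff [] : S a /\ J a by [].
pattern a; apply: Ha; last by move=> t ts; split; [apply: sSs | apply: sJ'].
split; first by move=> c [].
split; first by split; [apply: subring0 | apply: (ideal0 idJ')].
split=> [c d [Sc Jc] [Sd Jd]|r c Sr [Sc Jc]]; split.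
- exact: subringD.
- exact: (idealD idJ').
- exact: subringM.
- by apply: (idealM idJ') => //; apply: localization_inc.
Qed.

End Localization.

(** * The quadratic transform with parameters X / Y and Y *)

Section QuadraticTransform.
Variables (F : fieldType) (R : F -> Prop) (X Y : F) (reg : regular_params R X Y).

Let t := X / Y.
Let S := gen_ring R (fun z => z = t).
Let P := gen_ideal S (fun z => z = Y \/ z = t).
Let sR := reg_subring reg.
Let sS : subring S := gen_ring_subring R _.
Let Y0 : Y != 0 := reg_fst_neq0 (reg_swap reg).
Let X0 : X != 0 := reg_fst_neq0 reg.
Let Rn n : R (Y ^+ n) := subringX sR n (reg_snd reg).

Let SR a : R a -> S a. Proof. exact: gen_ring_base. Qed.
Let St : S t. Proof. exact: gen_ring_inc. Qed.
Let SY : S Y. Proof. by apply: SR; apply: (reg_snd reg). Qed.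

Let Yt : Y * t = X. Proof. by rewrite mulrC divfK. Qed.

Lemma transform_clear z : S z -> exists n, R (Y ^+ n * z).
Proof.
move=> Hz; pattern z; apply: Hz.
- split; first by exists 0%N; rewrite mulr0; apply: subring0.
  split; first by exists 0%N; rewrite mulr1; apply: Rn.
  split=> a b [n Ra] [m Rb]; exists (n + m)%N; rewrite exprD.
    have -> : Y ^+ n * Y ^+ m * (a - b) = Y ^+ m * (Y ^+ n * a) - Y ^+ n * (Y ^+ m * b) by ring.
    by apply: (subringB sR); apply: (subringM sR).
  have -> : Y ^+ n * Y ^+ m * (a * b) = (Y ^+ n * a) * (Y ^+ m * b) by ring.
  exact: (subringM sR).
- by move=> r Rr; exists 0%N; rewrite mul1r.
by move=> _ ->; exists 1%N; rewrite expr1 Yt; apply: (reg_fst reg).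
Qed.

(** R[t] = R + t R[t]: modulo [P] everything is a constant from R. Both properness and maximality of
    [P] come from this. *)
Lemma transform_constant z : S z -> exists c s, [/\ R c, S s & z = c + s * t].
Proof.
move=> Hz; pattern z; apply: Hz.
- split; first by exists 0, 0; split; [exact: (subring0 sR) | exact: (subring0 sS) | ring].
  split; first by exists 1, 0; split; [exact: (subring1 sR) | exact: (subring0 sS) | ring].
  split=> _ _ [c [s [Rc Ss ->]]] [c' [s' [Rc' Ss' ->]]].
    exists (c - c'), (s - s'); split; [exact: (subringB sR) | exact: (subringB sS) | ring].
  exists (c * c'), (c * s' + c' * s + s * s' * t); split; [exact: (subringM sR) | | ring].
  have Sc := SR Rc; have Sc' := SR Rc'.
  by apply: (subringD sS); [apply: (subringD sS)|]; do ![apply: (subringM sS) => //].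
- by move=> r Rr; exists r, 0; split=> //; [exact: (subring0 sS) | ring].
by move=> _ ->; exists 0, 1; split; [exact: (subring0 sR) | exact: (subring1 sS) | ring].
Qed.

Let PP z : P z <-> exists a b, [/\ S a, S b & z = a * Y + b * t].
Proof. exact: gen_ideal_pair. Qed.

Let idP : ideal_of S P.
Proof. by apply: gen_ideal_ideal => // _ [] ->. Qed.

Let Pt : P t. Proof. by apply: gen_ideal_inc; right. Qed.
Let PY : P Y. Proof. by apply: gen_ideal_inc; left. Qed.

(** If 1 = aY + bt with a = c + st, then 1 - cY = (sY + b) t. Multiplying by a high power of Y puts
    a unit times a power of Y into XR. *)
Let P1 : ~ P 1.
Proof.
move=> /PP[a [b [/transform_constant[c [s [Rc Ss ->]]] Sb E]]].
have [n Rw] := @transform_clear (s * Y + b) (subringD sS (subringM sS Ss SY) Sb).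
apply: (@unit_power_notin _ R X Y reg (1 + - (c * Y)) n.+1 (Y ^+ n * (s * Y + b))) => //.
  apply: unit_in_add_nonunit; [exact: (reg_local reg) | exact: unit_in1 |].
  have [_ idm] := reg_local reg.
  by apply: (idealN sR idm); apply: (idealM idm) => //; apply: (reg_nonunit_snd reg).
rewrite -Yt {1}E exprS; ring.
Qed.

Let unit_part c : R c -> P c \/ unit_in R c.
Proof.
move=> Rc; have [|] := unit_or_nonunit Rc; first by right.
move=> /(tg_max (reg_two_generated reg))[a [b [Ra Rb ->]]]; left.
by apply: (idealD idP); apply: (idealM idP); rewrite -?Yt;
  [apply: SR | apply: (idealM idP) | apply: SR | ].
Qed.

Let maxP a : S a -> P a \/ exists2 b, S b & P (1 - a * b).
Proof.
move=> /transform_constant[c [s [Rc Ss ->]]].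
have Pst : P (s * t) by apply: (idealM idP).
have [Pc|[c0 _ Rc']] := unit_part Rc; first by left; apply: (idealD idP).
right; exists c^-1; first exact: SR.
have -> : 1 - (c + s * t) * c^-1 = - c^-1 * (s * t) by field.
by apply: (idealM idP) => //; apply: (subringN sS); apply: SR.
Qed.

Let Q := adj_loc R t Y t.

Lemma transform_inc a : R a -> Q a.
Proof. by move=> Ra; apply: localization_inc => //; apply: SR. Qed.

Lemma transform_regular : regular_params Q t Y.
Proof.
have lQ : local_ring Q by apply: localization_local.
have sQ : subring Q by case: lQ.
have Qt : Q t by apply: localization_inc.
have QY : Q Y by apply: localization_inc.
split.
- split=> //.
    apply: localization_noetherian => //; apply: hilbert_basis => //.
    exact: (tg_noetherian (reg_two_generated reg)).
  move=> z; rewrite nonunits_localization //; split.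
    move=> [_ [b [/PP[c [d [Sc Sd ->]]] Sb Nb ->]]].
    have b0 := notin_max_neq0 idP Nb.
    exists (d / b), (c / b); split; [by exists d, b | by exists c, b | by field].
  move=> [c [d [Qc Qd ->]]]; apply/nonunits_localization => //.
  have [_ idm] := lQ.
  have Nn w : P w -> nonunits Q w.
    move=> Pw; apply/nonunits_localization => //; exists w, 1; split=> //; first exact: subring1.
    by rewrite invr1 mulr1.
  by apply: (idealD idm); apply: (idealM idm) => //; apply: Nn.
- by rewrite mulf_neq0 // invr_eq0.
(* From Y^n q = p t with q = c + st and c a unit of R follows c Y^n = (p - s Y^n) t. Clearing
   denominators by Y gives a unit times a power of Y in XR. *)
move=> n _ [p [q [Sp [Sq [Nq ->]]]]] E; have q0 := notin_max_neq0 idP Nq.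
have [c [s [Rc Ss Eq]]] := transform_constant Sq.
have [Pc|Uc] := unit_part Rc.
  by apply: Nq; rewrite Eq; apply: (idealD idP) => //; apply: (idealM idP).
have SYn : S (Y ^+ n) by apply: SR.
have [m Rw] := @transform_clear (p - s * Y ^+ n) (subringB sS Sp (subringM sS Ss SYn)).
apply: (@unit_power_notin _ R X Y reg c (n + m.+1)%N (Y ^+ m * (p - s * Y ^+ n)) Uc Rw).
have E' : Y ^+ n * c = (p - s * Y ^+ n) * t.
  have -> : c = q - s * t by rewrite Eq; ring.
  have -> : Y ^+ n * (q - s * t) = Y ^+ n * q - s * Y ^+ n * t by ring.
  by rewrite E; field.
have -> : c * Y ^+ (n + m.+1) = (Y ^+ n * c) * Y ^+ m.+1 by rewrite exprD; ring.
by rewrite E' exprSr -Yt; ring.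
Qed.

Lemma transform_denominator z : Q z ->
  exists u n, [/\ unit_in Q u, R (u * Y ^+ n) & R (u * Y ^+ n * z)].
Proof.
move=> [p [q [Sp [Sq [Nq ->]]]]]; have q0 := notin_max_neq0 idP Nq.
have [n Rp] := transform_clear Sp; have [m Rq] := transform_clear Sq.
exists q, (n + m)%N; split; first exact: unit_in_localization.
  have -> : q * Y ^+ (n + m) = Y ^+ n * (Y ^+ m * q) by rewrite exprD; ring.
  exact: (subringM sR).
have -> : q * Y ^+ (n + m) * (p / q) = Y ^+ m * (Y ^+ n * p) by rewrite exprD; field.
exact: (subringM sR).
Qed.

End QuadraticTransform.

(** * Two successive quadratic transforms *)

Lemma unit_in_sub (F : fieldType) (R S : F -> Prop) u :
  (forall z, R z -> S z) -> unit_in R u -> unit_in S u.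
Proof. by move=> RS [u0 Ru Ru']; split=> //; apply: RS. Qed.

(* [beta] is the point where the strict transform [s = 0] of the exceptional
   curve of [D] meets the exceptional curve [t = 0] of [alpha]. *)
Section DoubleTransform.
Variables (F : fieldType) (D : F -> Prop) (X Y : F) (reg : regular_params D X Y).

Let t := X / Y.
Let alpha := adj_loc D t Y t.
Let s := Y / t.
Let beta := adj_loc alpha s t s.

Let rega : regular_params alpha t Y := transform_regular reg.

Lemma double_transform_regular : regular_params beta s t.
Proof. exact: (transform_regular (reg_swap rega)). Qed.

Lemma double_transform_inc z : alpha z -> beta z.
Proof. exact: (transform_inc (reg_swap rega)). Qed.

Let regb := double_transform_regular.
Let ab := double_transform_inc.
Let sD : subring D := reg_subring reg.
Let sa : subring alpha := reg_subring rega.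
Let sb : subring beta := reg_subring regb.
Let s0 : s != 0 := reg_fst_neq0 regb.
Let t0 : t != 0 := reg_fst_neq0 rega.
Let bs : beta s := reg_fst regb.
Let bt : beta t := reg_snd regb.
Let bX z n : beta z -> beta (z ^+ n) := @subringX _ _ sb z n.
Let Est : Y = s * t. Proof. by rewrite /s divfK. Qed.

(** Denominators are cleared first by a power of t, down to [alpha], then by powers of Y = st, down
    to D, for the first denominator and for its product with z. *)
Lemma double_transform_denominator z : beta z -> exists u i j,
  [/\ unit_in beta u, D (u * s ^+ i * t ^+ j) & D (u * s ^+ i * t ^+ j * z)].
Proof.
move=> /(transform_denominator (reg_swap rega))[u [n [Uu a1 a2]]].
have [v [m [Uv Dv Dv1]]] := transform_denominator reg a1.
have [w [l [Uw Dw Dw2]]] := transform_denominator reg a2.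
have Uv' := unit_in_sub ab Uv; have Uw' := unit_in_sub ab Uw.
have E : u * v * w * s ^+ (m + l) * t ^+ (m + l + n) =
    w * Y ^+ l * (v * Y ^+ m * (u * t ^+ n)).
  by rewrite Est !exprD !exprMn; ring.
exists (u * v * w), (m + l)%N, (m + l + n)%N; split.
- by apply: (unit_inM sb) => //; apply: (unit_inM sb).
- by rewrite E; apply: (subringM sD).
rewrite E.
have -> : w * Y ^+ l * (v * Y ^+ m * (u * t ^+ n)) * z =
  v * Y ^+ m * (w * Y ^+ l * (u * t ^+ n * z)) by ring.
exact: (subringM sD).
Qed.

(** Since Y = st, and [u * t ^+ e + Y * h] is [u * t ^+ e] modulo s, the left side has s-order
    exactly n. *)
Lemma order_le u n e h m z : unit_in alpha u -> alpha h -> beta z ->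
  Y ^+ n * (u * t ^+ e + Y * h) = s ^+ m * z -> (m <= n)%N.
Proof.
move=> Uu ah bz E; rewrite leqNgt; apply/negP => nm.
have bh := ab ah.
apply: (@unit_power_notin _ _ _ _ regb u (n + e) (s ^+ (m - n.+1) * z - t ^+ n.+1 * h)).
- exact: (unit_in_sub ab).
- by apply: (subringB sb); apply: (subringM sb) => //; apply: bX.
have E' : t ^+ n * (u * t ^+ e + s * t * h) = s ^+ (m - n.+1) * s * z.
  apply: (mulfI (expf_neq0 n s0)); rewrite mulrA -exprMn -Est E.
  by rewrite -{1}(subnK nm) exprD exprS; ring.
have -> : (s ^+ (m - n.+1) * z - t ^+ n.+1 * h) * s =
  s ^+ (m - n.+1) * s * z - t ^+ n.+1 * h * s by ring.
by rewrite -E' exprD exprS; ring.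
Qed.

(** If m < n, the difference is a unit times t^m, which is not divisible by s. *)
Lemma sub_powers_unit u v m n a : unit_in beta u -> unit_in beta v -> beta a ->
  u * t ^+ m - v * t ^+ n = a * s -> m = n.
Proof.
wlog mn : u v m n a / (m <= n)%N.
  move=> H Uu Uv ba E; have [mn|/ltnW nm] := leqP m n; first exact: (H u v m n a).
  apply: esym; apply: (H v u n m (- a)) => //; first exact: (subringN sb).
  by rewrite mulNr -E; ring.
move=> Uu [_ bv _] ba E; move: mn; rewrite leq_eqVlt => /orP[/eqP//|mn]; exfalso.
apply: (@unit_power_notin _ _ _ _ regb (u + - (v * t ^+ (n - m.+1) * t)) m a) => //.
  apply: unit_in_add_nonunit => //; first exact: (reg_local regb).
  have [_ idm] := reg_local regb.
  apply: (idealN sb idm); apply: (idealM idm); last exact: (reg_nonunit_snd regb).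
  by apply: (subringM sb) => //; apply: bX.
by rewrite -E -{2}(subnK mn) exprD exprS; ring.
Qed.

(** Comparing s-orders gives i = n; then comparing t-orders modulo s gives j = n + e. So the
    monomial and [Y ^+ n * (u * t ^+ e)] differ by a unit. *)
Lemma initial_monomial_unit u n e h v i j : unit_in alpha u -> alpha h -> unit_in beta v ->
  Y ^+ n * (u * t ^+ e + Y * h) = v * s ^+ i * t ^+ j ->
  unit_in beta (v * s ^+ i * t ^+ j / (Y ^+ n * (u * t ^+ e))).
Proof.
move=> Uu ah Uv E; have Uu' := unit_in_sub ab Uu; have bh := ab ah.
have [[u0 bu _] [v0 bv _]] := (Uu', Uv).
have le_in : (i <= n)%N.
  apply: (@order_le u n e h i (v * t ^+ j)) => //; last by rewrite E; ring.
  by apply: (subringM sb) => //; apply: bX.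
move: le_in; rewrite leq_eqVlt => /orP[/eqP Ei|lt_in]; last first.
  case: (@unit_power_notin _ _ _ _ regb v j
    (s ^+ (n - i.+1) * t ^+ n * (u * t ^+ e + Y * h))) => //.
    apply: (subringM sb); first by apply: (subringM sb); apply: bX.
    apply: (subringD sb); apply: (subringM sb) => //; first exact: bX.
    by apply: ab; apply: (reg_snd rega).
  apply: (mulfI (expf_neq0 i s0)).
  have -> : s ^+ i * (v * t ^+ j) = v * s ^+ i * t ^+ j by ring.
  by rewrite -E Est exprMn -{1}(subnK lt_in) exprD exprS; ring.
have E' : t ^+ n * (u * t ^+ e + s * t * h) = v * t ^+ j.
  apply: (mulfI (expf_neq0 n s0)); rewrite mulrA -exprMn -Est E Ei; ring.
have Ej : (n + e)%N = j.
  apply: (@sub_powers_unit u v _ _ (- (t ^+ n.+1 * h))) => //.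
    by apply: (subringN sb); apply: (subringM sb) => //; apply: bX.
  by rewrite -E' exprD exprS; ring.
have -> : v * s ^+ i * t ^+ j / (Y ^+ n * (u * t ^+ e)) = v * u^-1.
  rewrite Ei -Ej Est [(s * t) ^+ n]exprMn exprD.
  move: (expf_neq0 n s0) (expf_neq0 n t0) (expf_neq0 e t0).
  move: (s ^+ n) (t ^+ n) (t ^+ e) => p q r p0 q0 r0.
  by field; rewrite u0 p0 q0 r0.
by apply: (unit_inM sb) => //; apply: unit_inV.
Qed.

(** The prime s does not divide t^e, so each factor s must come from z. *)
Lemma saturate_fst z w e d : beta z -> beta w -> z * t ^+ e = s ^+ d * w ->
  exists2 z', beta z' & z = s ^+ d * z'.
Proof.
elim: d z w => [|d IH] z w bz bw E; first by exists z; rewrite ?mul1r.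
have [z1 bz1 E1] : exists2 z1, beta z1 & z = s ^+ d * z1.
  apply: (IH z (s * w)) => //; first exact: (subringM sb).
  by rewrite E exprSr; ring.
have E2 : z1 * t ^+ e = w * s.
  by apply: (mulfI (expf_neq0 d s0)); rewrite mulrA -E1 E exprSr; ring.
have [[z2 bz2 Ez]|[c bc Ec]] : multiples beta s z1 \/ multiples beta s (t ^+ e).
- by apply: (reg_fst_prime regb) => //; [apply: bX | exists w].
- by exists z2 => //; rewrite E1 Ez exprSr; ring.
by case: (@reg_power_notin _ _ _ _ regb e c).
Qed.

(** This bounds a pole order by a difference of degrees. After cancelling Y^N, the right side is
    divisible by s^d, hence so is z c; removing s^d leaves, modulo s, t-order at least e on the left
    and exactly d + e' on the right. *)
Lemma initial_exponent_le z c u h N d e e' : beta z -> unit_in alpha c ->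
  unit_in alpha u -> alpha h ->
  z * (Y ^+ N * (c * t ^+ e)) = Y ^+ (N + d) * (u * t ^+ e' + Y * h) ->
  (e <= d + e')%N.
Proof.
move=> bz Uc Uu ah E; have Uc' := unit_in_sub ab Uc; have Uu' := unit_in_sub ab Uu.
have [[_ bc _] [_ bu _]] := (Uc', Uu'); have bh := ab ah.
have Y0 : Y != 0 by rewrite Est mulf_neq0.
have E1 : z * c * t ^+ e = s ^+ d * (t ^+ d * (u * t ^+ e' + Y * h)).
  apply: (mulfI (expf_neq0 N Y0)).
  have -> : Y ^+ N * (z * c * t ^+ e) = z * (Y ^+ N * (c * t ^+ e)) by ring.
  have -> : s ^+ d * (t ^+ d * (u * t ^+ e' + Y * h)) = Y ^+ d * (u * t ^+ e' + Y * h).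
    by rewrite mulrA -exprMn -Est.
  by rewrite E exprD mulrA.
have [||z' bz' Ez'] := saturate_fst _ _ E1.
- exact: (subringM sb).
- apply: (subringM sb); first exact: bX.
  apply: (subringD sb); apply: (subringM sb) => //; first exact: bX.
  by apply: ab; apply: (reg_snd rega).
have E2 : z' * t ^+ e = t ^+ d * (u * t ^+ e' + s * t * h).
  by apply: (mulfI (expf_neq0 d s0)); rewrite mulrA -Ez' E1 -Est.
rewrite leqNgt; apply/negP => lt_e.
case: (@unit_power_notin _ _ _ _ regb (u + - (z' * t ^+ (e - (d + e').+1) * t)) (d + e')
  (- (t ^+ d.+1 * h))).
- apply: unit_in_add_nonunit => //; first exact: (reg_local regb).
  have [_ idm] := reg_local regb.
  apply: (idealN sb idm); apply: (idealM idm); last exact: (reg_nonunit_snd regb).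
  by apply: (subringM sb) => //; apply: bX.
- by apply: (subringN sb); apply: (subringM sb) => //; apply: bX.
have -> : (u + - (z' * t ^+ (e - (d + e').+1) * t)) * t ^+ (d + e') =
  u * t ^+ (d + e') - z' * t ^+ (e - (d + e').+1 + (d + e').+1).
  by rewrite !exprD exprSr exprD; ring.
by rewrite subnK // E2 exprD exprS; ring.
Qed.

End DoubleTransform.

(** * The points of the exceptional line *)

(** Synthetic division, from the top coefficient downwards. *)
Lemma poly_in_div_root (F : fieldType) (K : F -> Prop) (p q : {poly F}) c :
  subring K -> K c -> poly_in K p -> p = q * ('X - c%:P) -> poly_in K q.
Proof.
move=> sK Kc Kp E; suff H m i : (size q <= i + m)%N -> K q`_i.
  by move=> i; apply: (H (size q)); rewrite leq_addl.
elim: m i => [|m IH] i qi.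
  by rewrite nth_default; [apply: subring0 | rewrite -[i]addn0].
have -> : q`_i = p`_i.+1 + q`_i.+1 * c.
  by rewrite E mulrBr coefB coefMX coefMC subrK.
by apply: subringD => //; apply: subringM => //; apply: IH; rewrite addSnnS.
Qed.

(* The points of the projective line over k: [Some a] is the zero of [x + a y],
   [None] the zero of [y]. *)
Section ProjectiveLine.
Variables (F : fieldType) (D k : F -> Prop) (x y : F).
Hypotheses (dimD : krull_dim_ge D 2) (tgD : two_generated D x y).
Hypotheses (hk : coefficient_field D k) (hkc : alg_closed_subfield k).

Let A := ringA D k x y.
Let mA := idealmA D k x y.
Let sD : subring D := tg_subring tgD.
Let Dx : D x := tg_fst tgD.
Let Dy : D y := tg_snd tgD.
Let sk : subring k. Proof. by case: hk => -[]. Qed.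
Let kV a : k a -> a != 0 -> k a^-1. Proof. by case: hk => -[_ h] _; apply: h. Qed.
Let kD a : k a -> D a. Proof. by case: hk => _ [h _]; apply: h. Qed.
Let k0 : k 0 := subring0 sk.
Let k1 : k 1 := subring1 sk.
Let unit_k a : k a -> a != 0 -> unit_in D a.
Proof. by move=> ka a0; split=> //; apply: kD => //; apply: kV. Qed.

Definition on_line (o : option F) := if o is Some a then k a else True.
Definition lin (o : option F) := if o is Some a then x + a * y else y.
(** A linear form independent of [lin o], so that the two generate the maximal ideal and
    [cof o ^+ 2 / lin o] is the generator of A attached to the point. *)
Definition cof (o : option F) := if o is Some _ then y else x.

Lemma xy_lin_cof o : on_line o -> exists a b c d,
  [/\ k a, k b, k c & k d] /\ x = a * lin o + b * cof o /\ y = c * lin o + d * cof o.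
Proof.
case: o => [a|] /= ka; last by exists 0, 1, 1, 0; split=> //; split; ring.
exists 1, (- a), 0, 1; split; first by split=> //; apply: subringN.
by split; ring.
Qed.

Lemma lin_lin_cof o o' : on_line o -> on_line o' -> o' != o ->
  exists a b, [/\ k a, k b, b != 0 & lin o' = a * lin o + b * cof o].
Proof.
case: o o' => [a|] [b|] //= ka kb ne.
- exists 1, (b - a); split=> //; [exact: subringB | | ring].
  by rewrite subr_eq0; apply: contraNneq ne => ->.
- by exists 0, 1; split; rewrite ?oner_eq0 //; ring.
by exists b, 1; split; rewrite ?oner_eq0 //; ring.
Qed.

Lemma lin_D o : on_line o -> D (lin o).
Proof.
by case: o => //= a ka; apply: subringD => //; apply: subringM => //; apply: kD.
Qed.

Lemma cof_D o : D (cof o). Proof. by case: o. Qed.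

Lemma line_regular o : on_line o -> regular_params D (lin o) (cof o).
Proof.
move=> vo; apply: dim2_regular_params => //.
split; [exact: (tg_local tgD) | exact: (tg_noetherian tgD) | exact: lin_D | exact: cof_D |].
move=> z; split.
  move=> /(tg_max tgD)[a [b [Da Db ->]]].
  have [p [q [r [s [[kp kq kr ks] [{1}-> {1}->]]]]]] := xy_lin_cof vo.
  exists (a * p + b * r), (a * q + b * s); split; last by ring.
    by apply: subringD => //; apply: subringM => //; apply: kD.
  by apply: subringD => //; apply: subringM => //; apply: kD.
have [_ idm] := tg_local tgD.
have Nx := tg_nonunit_fst tgD; have Ny := tg_nonunit_snd tgD.
move=> [a [b [Da Db ->]]]; apply: (idealD idm); apply: (idealM idm) => //; last by case: (o).
by case: (o) vo => //= c kc; apply: (idealD idm) => //; apply: (idealM idm) => //; apply: kD.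
Qed.

Definition tpar o := lin o / cof o.
Definition alpha o := adj_loc D (tpar o) (cof o) (tpar o).
Definition spar o := cof o / tpar o.
Definition beta o := adj_loc (alpha o) (spar o) (tpar o) (spar o).

Lemma spar_gen o : spar o = cof o ^+ 2 / lin o.
Proof. by rewrite /spar /tpar invf_div expr2 mulrA. Qed.

Lemma beta_Some a : beta (Some a) = beta_a D x y a.
Proof. by rewrite /beta /beta_a spar_gen. Qed.

Lemma beta_None : beta None = beta' D x y.
Proof. by rewrite /beta /beta' spar_gen. Qed.

Lemma gensAP z : gensA k x y z <-> exists2 o, on_line o & z = cof o ^+ 2 / lin o.
Proof.
split=> [[[a [ka ->]]|->]|[[a|] ka ->]].
- by exists (Some a).
- by exists None.
- by left; exists a.
- by right.
Qed.

(** * Local computations at one point of the line *)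

Section Point.
Variables (o : option F) (vo : on_line o).
Let reg := line_regular vo.
Let t := tpar o.
Let s := spar o.
Let Y := cof o.

Lemma alpha_regular : regular_params (alpha o) t Y.
Proof. exact: (transform_regular reg). Qed.
Lemma beta_regular : regular_params (beta o) s t.
Proof. exact: (double_transform_regular reg). Qed.
Lemma D_alpha z : D z -> alpha o z. Proof. exact: (transform_inc reg). Qed.
Lemma alpha_beta z : alpha o z -> beta o z. Proof. exact: (double_transform_inc reg). Qed.
Lemma D_beta z : D z -> beta o z. Proof. by move/D_alpha/alpha_beta. Qed.
Lemma lin_neq0 : lin o != 0. Proof. exact: (reg_fst_neq0 reg). Qed.
Lemma cof_neq0 : Y != 0. Proof. exact: (reg_fst_neq0 (reg_swap reg)). Qed.
Lemma cof_st : Y = s * t.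
Proof. by rewrite /s /spar divfK //; apply: (reg_fst_neq0 alpha_regular). Qed.
Lemma lin_t : lin o = Y * t.
Proof. by rewrite /t /tpar mulrC divfK //; apply: cof_neq0. Qed.

Let sa := reg_subring alpha_regular.
Let sb := reg_subring beta_regular.

Lemma k_alpha c : k c -> alpha o c. Proof. by move/kD/D_alpha. Qed.

Lemma unit_k_alpha c : k c -> c != 0 -> unit_in (alpha o) c.
Proof. by move=> kc c0; apply: (unit_in_sub D_alpha); apply: unit_k. Qed.

Lemma cof_nonunit : nonunits (beta o) Y.
Proof.
have [_ idm] := reg_local beta_regular; rewrite cof_st; apply: (idealM idm).
  exact: (reg_fst beta_regular).
exact: (reg_nonunit_snd beta_regular).
Qed.

Lemma xy_alpha : multiples (alpha o) Y x /\ multiples (alpha o) Y y.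
Proof.
have [a [b [c [d [[ka kb kc kd] [Ex Ey]]]]]] := xy_lin_cof vo.
have at_ := reg_fst alpha_regular.
split; [exists (a * t + b) | exists (c * t + d)]; rewrite ?{1}Ex ?{1}Ey ?lin_t -?/Y; try ring.
  by apply: (subringD sa); [apply: (subringM sa) => //|]; apply: k_alpha.
by apply: (subringD sa); [apply: (subringM sa) => //|]; apply: k_alpha.
Qed.

Lemma lin_off o' : on_line o' -> o' != o -> exists2 u, unit_in (alpha o) u & lin o' = Y * u.
Proof.
move=> vo' ne; have [a [b [ka kb b0 E]]] := lin_lin_cof vo vo' ne.
exists (b + a * t); last by rewrite E lin_t -/Y; ring.
apply: unit_in_add_nonunit; [exact: (reg_local alpha_regular) | exact: unit_k_alpha |].
have [_ idm] := reg_local alpha_regular.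
apply: (idealM idm); first exact: k_alpha.
exact: (reg_nonunit_fst alpha_regular).
Qed.

(** Away from its own point, the generator has numerator in Y^2 alpha and denominator Y times a
    unit. Both the inclusion of A in every [beta] and the failure of the Noetherian property rest on
    this. *)
Lemma gen_off o' : on_line o' -> o' != o -> multiples (alpha o) Y (cof o' ^+ 2 / lin o').
Proof.
move=> vo' ne; have [u [u0 au au'] ->] := lin_off vo' ne.
have [w aw ->] : multiples (alpha o) Y (cof o').
  by case: (o') => [a|] /=; case: xy_alpha.
exists (w ^+ 2 * u^-1); first by apply: (subringM sa) => //; apply: (subringX sa).
by field; rewrite u0 cof_neq0.
Qed.

Lemma multiples_nonunit z : multiples (alpha o) Y z -> nonunits (beta o) z.
Proof.
move=> [w aw ->]; have [_ idm] := reg_local beta_regular.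
by apply: (idealM idm); [apply: alpha_beta | apply: cof_nonunit].
Qed.

Lemma gen_nonunit z : gensA k x y z -> nonunits (beta o) z.
Proof.
move=> /gensAP[o' vo' ->]; have [->|ne] := eqVneq o' o.
  by rewrite -spar_gen; apply: (reg_nonunit_fst beta_regular).
by apply: multiples_nonunit; apply: gen_off.
Qed.

Lemma A_beta z : A z -> beta o z.
Proof.
by move=> Az; apply: Az => // [r /D_beta|g /gen_nonunit[]].
Qed.

Lemma mA_nonunit z : mA z -> nonunits (beta o) z.
Proof.
move=> mz; have [_ idm] := reg_local beta_regular.
suff [] : A z /\ nonunits (beta o) z by [].
have sA : subring A by apply: gen_ring_subring.
have gA g : g = x \/ g = y \/ gensA k x y g -> A g.
  by case=> [->|[->|gg]]; [apply: gen_ring_base | apply: gen_ring_base | apply: gen_ring_inc].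
pattern z; apply: mz.
  split; first by move=> a [].
  split; first by split; [apply: (subring0 sA) | apply: (ideal0 idm)].
  split=> [a b [Aa Na] [Ab Nb]|r a Ar [Aa Na]]; split.
  - exact: (subringD sA).
  - exact: (idealD idm).
  - exact: (subringM sA).
  - by apply: (idealM idm) => //; apply: A_beta.
move=> g Hg; split; first exact: gA.
have [xa ya] := xy_alpha.
by case: Hg => [->|[->|]]; [apply: multiples_nonunit|apply: multiples_nonunit|apply: gen_nonunit].
Qed.

End Point.

(** * The ring A, its maximal ideal and the localization C *)

Let sA : subring A. Proof. exact: gen_ring_subring. Qed.
Let DA z : D z -> A z. Proof. exact: gen_ring_base. Qed.

Lemma gen_A o : on_line o -> A (cof o ^+ 2 / lin o).
Proof. by move=> vo; apply: gen_ring_inc; apply/gensAP; exists o. Qed.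

Lemma mA_ideal : ideal_of A mA.
Proof.
apply: gen_ideal_ideal => // z [->|[->|gz]]; [exact: DA | exact: DA |].
exact: gen_ring_inc.
Qed.

Lemma mA_proper : ~ mA 1.
Proof.
move=> /(@mA_nonunit None I)[_]; apply; exists 1; rewrite mulr1; split=> //.
exact: (subring1 (reg_subring (@beta_regular None I))).
Qed.

(** The adjoined generators lie in [mA] and D is k plus its maximal ideal, so A has residue field k
    at [mA]. *)
Lemma A_constant z : A z -> exists2 c, k c & mA (z - c).
Proof.
move=> Az; suff [] : A z /\ exists2 c, k c & mA (z - c) by [].
have idm := mA_ideal.
pattern z; apply: Az.
- split; first by split; [apply: (subring0 sA) | exists 0; rewrite ?subr0 //; apply: (ideal0 idm)].
  split; first by split; [apply: (subring1 sA) | exists 1; rewrite ?subrr //; apply: (ideal0 idm)].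
  split=> a b [Aa [c kc mc]] [Ab [d kd md]]; split.
  + exact: (subringB sA).
  + exists (c - d); first exact: (subringB sk).
    have -> : a - b - (c - d) = (a - c) - (b - d) by ring.
    exact: (idealB sA idm).
  + exact: (subringM sA).
  exists (c * d); first exact: (subringM sk).
  have -> : a * b - c * d = b * (a - c) + c * (b - d) by ring.
  by apply: (idealD idm); apply: (idealM idm) => //; apply: DA; apply: kD.
- move=> d Dd; split; first exact: DA.
  have [_ [_ [h _]]] := hk; have [c [kc]] := h d Dd.
  move=> /(tg_max tgD)[a [b [Da Db E]]]; exists c => //; rewrite E.
  by apply: (idealD idm); apply: (idealM idm); try exact: DA;
    apply: gen_ideal_inc; [left|right; left].
move=> g gg; split; first exact: gen_ring_inc.
by exists 0 => //; rewrite subr0; apply: gen_ideal_inc; right; right.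
Qed.

Lemma mA_maximal a : A a -> mA a \/ exists2 b, A b & mA (1 - a * b).
Proof.
move=> Aa; have [c kc mc] := A_constant Aa; have idm := mA_ideal.
have [c0|c0] := eqVneq c 0; first by left; rewrite -[a]subr0 -c0.
right; exists c^-1; first by apply: DA; apply: kD; apply: kV.
have -> : 1 - a * c^-1 = - c^-1 * (a - c) by field.
by apply: (idealM idm) => //; apply: (subringN sA); apply: DA; apply: kD; apply: kV.
Qed.

Lemma C_local : local_ring (ringC D k x y).
Proof.
exact: (localization_local sA mA_ideal mA_proper mA_maximal).
Qed.

Lemma notin_mA_constant q : A q -> ~ mA q -> exists c, [/\ k c, c != 0 & mA (q - c)].
Proof.
move=> Aq Nq; have [c kc mc] := A_constant Aq; exists c; split=> //.
by apply/eqP => c0; apply: Nq; rewrite -[q]subr0 -c0.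
Qed.

Lemma C_beta o z : on_line o -> ringC D k x y z -> beta o z.
Proof.
move=> vo [p [q [Ap [Aq [Nq ->]]]]].
have [c [kc c0 mc]] := notin_mA_constant Aq Nq.
have regb := beta_regular vo; have sb := reg_subring regb.
have [_ _ bq'] : unit_in (beta o) q.
  rewrite -[q](subrK c) addrC; apply: unit_in_add_nonunit; first exact: (reg_local regb).
    by apply: (unit_in_sub (alpha_beta vo)); apply: unit_k_alpha.
  exact: mA_nonunit.
by apply: (subringM sb) => //; apply: A_beta.
Qed.

(** For K = k these are the forms of degree n in x and y; for K = D they make up the n-th power of
    the maximal ideal. *)
Fixpoint forms (K : F -> Prop) n : F -> Prop :=
  if n is n'.+1 then fun z => exists u v, [/\ forms K n' u, forms K n' v & z = x * u + y * v]
  else K.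

Section Forms.
Variables (K : F -> Prop) (sK : subring K) (kK : forall c, k c -> K c).

Lemma forms0 n : forms K n 0.
Proof.
by elim: n => [|n IH]; [apply: subring0 | exists 0, 0; split=> //; ring].
Qed.

Lemma formsD n a b : forms K n a -> forms K n b -> forms K n (a + b).
Proof.
elim: n a b => [|n IH] a b /=; first exact: subringD.
move=> [u [v [Ku Kv ->]]] [u' [v' [Ku' Kv' ->]]].
by exists (u + u'), (v + v'); split; [apply: IH | apply: IH | ring].
Qed.

Lemma formsZ n c a : K c -> forms K n a -> forms K n (c * a).
Proof.
move=> Kc; elim: n a => [|n IH] a /=; first exact: subringM.
by move=> [u [v [Ku Kv ->]]]; exists (c * u), (c * v); split; [apply: IH | apply: IH | ring].
Qed.

Lemma formsB n a b : forms K n a -> forms K n b -> forms K n (a - b).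
Proof.
move=> Ka Kb; apply: formsD => //; rewrite -mulN1r; apply: formsZ => //.
by apply: (subringN sK); apply: subring1.
Qed.

Lemma forms_mulx n a : forms K n a -> forms K n.+1 (x * a).
Proof. by move=> Ka; exists a, 0; split=> //; [apply: forms0 | ring]. Qed.

Lemma forms_muly n a : forms K n a -> forms K n.+1 (y * a).
Proof. by move=> Ka; exists 0, a; split=> //; [apply: forms0 | ring]. Qed.

Lemma forms_lin o n a : on_line o -> forms K n a -> forms K n.+1 (lin o * a).
Proof.
case: o => [c|] vo Ka /=; last exact: forms_muly.
exists a, (c * a); split=> //; [by apply: formsZ => //; apply: kK | ring].
Qed.

Lemma forms_cof o n a : forms K n a -> forms K n.+1 (cof o * a).
Proof. by case: o => [c|] Ka; [apply: forms_muly | apply: forms_mulx]. Qed.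

Lemma forms_cofX o n m a : forms K n a -> forms K (m + n) (cof o ^+ m * a).
Proof.
move=> Ka; elim: m => [|m IH]; first by rewrite mul1r.
by rewrite exprS -mulrA; apply: (forms_cof o IH).
Qed.

Lemma forms_split o n z : on_line o -> forms K n.+1 z ->
  exists u v, [/\ forms K n u, forms K n v & z = lin o * u + cof o * v].
Proof.
move=> vo [u [v [Ku Kv ->]]].
have [a [b [c [d [[ka kb kc kd] [Ex Ey]]]]]] := xy_lin_cof vo.
exists (a * u + c * v), (b * u + d * v); split.
- by apply: formsD; apply: formsZ => //; apply: kK.
- by apply: formsD; apply: formsZ => //; apply: kK.
by rewrite {1}Ex {1}Ey; ring.
Qed.

Definition prodlin (l : seq (option F)) := \prod_(o <- l) lin o.

Lemma prodlin_cons o l : prodlin (o :: l) = lin o * prodlin l.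
Proof. exact: big_cons. Qed.

Lemma forms_prodlin l : (forall o, o \in l -> on_line o) -> forms K (size l) (prodlin l).
Proof.
elim: l => [|o l IH] vl; first by rewrite /prodlin big_nil; apply: subring1.
rewrite prodlin_cons; apply: forms_lin; first by apply: vl; rewrite mem_head.
by apply: IH => o' o'l; apply: vl; rewrite inE o'l orbT.
Qed.

End Forms.

Lemma forms_D n z : forms D n z -> D z.
Proof.
elim: n z => //= n IH z [u [v [/IH Du /IH Dv ->]]].
by apply: subringD => //; apply: subringM.
Qed.

Lemma forms_k_D n z : forms k n z -> forms D n z.
Proof.
elim: n z => [|n IH] z /=; first exact: kD.
by move=> [u [v [/IH Du /IH Dv ->]]]; exists u, v.
Qed.

Lemma forms_weaken n z : forms D n.+1 z -> forms D n z.
Proof.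
elim: n z => [|n IH] z [u [v [Du Dv ->]]].
  by apply: subringD => //; apply: subringM.
by exists u, v; split=> //; apply: IH.
Qed.

(** The coefficients in D are replaced by their residues in k. *)
Lemma initial_form n z : forms D n z -> exists2 p, forms k n p & forms D n.+1 (z - p).
Proof.
elim: n z => [|n IH] z.
  move=> Dz; have [_ [_ [h _]]] := hk; have [c [kc]] := h z Dz.
  move=> /(tg_max tgD)[a [b [Da Db E]]]; exists c => //.
  by exists a, b; split=> //; rewrite E; ring.
move=> [u [v [/IH[p kp Dp] /IH[q kq Dq] ->]]].
exists (x * p + y * q); first by exists p, q.
by exists (u - p), (v - q); split=> //; ring.
Qed.

Lemma forms_alpha o n z : on_line o -> forms D n z ->
  exists2 w, alpha o w & z = cof o ^+ n * w.
Proof.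
move=> vo; have sa := reg_subring (alpha_regular vo).
elim: n z => [|n IH] z; first by move=> Dz; exists z; [apply: D_alpha | rewrite mul1r].
move=> [u [v [/IH[u' au ->] /IH[v' av ->] ->]]].
have [[a aa Ea] [b bb Eb]] := xy_alpha vo.
exists (a * u' + b * v'); first by apply: (subringD sa); apply: (subringM sa).
by rewrite exprS {1}Ea {1}Eb; ring.
Qed.

(** Division by [lin o]; the remainder [c] is the value of the form at the point, normalized by
    [cof o] = 1. *)
Lemma form_eval o n z : on_line o -> forms k n.+1 z ->
  exists c u, [/\ k c, forms k n u & z = lin o * u + c * cof o ^+ n.+1].
Proof.
move=> vo; elim: n z => [|n IH] z /(forms_split sk (fun _ => id) vo)[u [v [ku kv ->]]].
  by exists v, u; split=> //; rewrite expr1; ring.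
have [c [w [kc kw ->]]] := IH v kv.
exists c, (u + cof o * w); split=> //; last by rewrite !exprS; ring.
by apply: (formsD sk) => //; apply: (forms_cof sk).
Qed.

(** The value at a point off the zeros is nonzero. Stating the degree for [cof o * u] avoids a
    predecessor and covers the empty product, where u = 0. *)
Lemma prodlin_eval o l : on_line o -> (forall o', o' \in l -> on_line o') -> o \notin l ->
  exists c u, [/\ k c, c != 0, forms k (size l) (cof o * u) &
    prodlin l = lin o * u + c * cof o ^+ size l].
Proof.
move=> vo; elim: l => [|b l IH] vl ol.
  exists 1, 0; rewrite oner_eq0 mulr0; split=> //.
  by rewrite /prodlin big_nil; ring.
have vb : on_line b by apply: vl; rewrite mem_head.
have {}vl o' : o' \in l -> on_line o' by move=> h; apply: vl; rewrite inE h orbT.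
move: ol; rewrite inE negb_or eq_sym => /andP[bo ol].
have [c [u [kc c0 ku E]]] := IH vl ol.
have [p [q [kp kq q0 Eb]]] := lin_lin_cof vo vb bo.
exists (q * c), (p * prodlin l + q * (cof o * u)); split.
- exact: subringM.
- by rewrite mulf_neq0.
- have -> : cof o * (p * prodlin l + q * (cof o * u)) =
    p * (cof o * prodlin l) + q * (cof o * (cof o * u)) by ring.
  apply: (formsD sk); apply: (formsZ sk) => //; apply: (forms_cof sk) => //.
  exact: (forms_prodlin sk).
rewrite /= prodlin_cons Eb exprS mulrDl [X in _ + _ * X = _]E; ring.
Qed.

(** * Products of linear forms and partial fractions *)

Lemma prodlin_neq0 l : (forall o, o \in l -> on_line o) -> prodlin l != 0.
Proof.
move=> vl; rewrite /prodlin prodf_seq_neq0; apply/allP => o ol /=.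
by apply: lin_neq0; apply: vl.
Qed.

Lemma prodlin_count o l :
  prodlin l = lin o ^+ count_mem o l * prodlin [seq o' <- l | o' != o].
Proof.
elim: l => [|b l IH]; first by rewrite /prodlin big_nil mulr1.
rewrite prodlin_cons {}IH /=; have [->|ne] := eqVneq b o.
  by rewrite add1n exprS; ring.
by rewrite add0n prodlin_cons; ring.
Qed.

(** One pole is removed at a time: a multiple of cof^(e+1+d) / lin^(e+1) is subtracted, chosen so
    that the new numerator becomes divisible by [lin o]. *)
Lemma partial_fractions l d f : (forall o, o \in l -> on_line o) ->
  (forall o, (count_mem o l <= d)%N) -> forms k (size l + d) f -> A (f / prodlin l).
Proof.
elim: l f => [|o l IH] f vl cl kf.
  rewrite /prodlin big_nil divr1; apply: DA; apply: (@forms_D d).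
  exact: forms_k_D.
have vo : on_line o by apply: vl; rewrite mem_head.
have vl' o' : o' \in l -> on_line o' by move=> h; apply: vl; rewrite inE h orbT.
set r := [seq o' <- l | o' != o].
have vr o' : o' \in r -> on_line o' by rewrite mem_filter => /andP[_ /vl'].
have or : o \notin r by rewrite mem_filter eqxx.
set e := count_mem o l.
have se : size l = (e + size r)%N by rewrite -(count_predC (pred1 o) l) /e /r size_filter.
have [cf [f' [kcf kf' Ef]]] := form_eval vo kf.
have [cr [u [kcr cr0 ku Er]]] := prodlin_eval vo vr or.
have El : prodlin l = lin o ^+ e * prodlin r by apply: prodlin_count.
pose c := cf / cr.
have kc : k c by apply: subringM => //; apply: kV.
pose g := f' - c * (cof o ^+ (e + d) * (cof o * u)).
have kg : forms k (size l + d) g.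
  apply: (formsB sk) => //; apply: (formsZ sk) => //.
  have -> : (size l + d = e + d + size r)%N by rewrite se; lia.
  exact: (forms_cofX sk).
have l0 := lin_neq0 vo; have r0 := prodlin_neq0 vr.
have Efg : f = lin o * g + c * (cof o ^+ (e.+1 + d) * prodlin r).
  rewrite Ef /g Er /c.
  have -> : cof o ^+ (size l + d).+1 = cof o ^+ (e.+1 + d) * cof o ^+ size r.
    by rewrite -exprD se; congr (_ ^+ _); lia.
  by rewrite addSn exprS; field.
have ed : (e.+1 <= d)%N by have := cl o; rewrite /= eqxx add1n.
have -> : f / prodlin (o :: l) =
    g / prodlin l + c * ((cof o ^+ 2 / lin o) ^+ e.+1 * cof o ^+ (d - e.+1)).
  rewrite prodlin_cons El Efg.
  have -> : (e.+1 + d = e.+1 + e.+1 + (d - e.+1))%N by lia.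
  have -> : (cof o ^+ 2 / lin o) ^+ e.+1 =
      cof o ^+ e.+1 * cof o ^+ e.+1 / (lin o * lin o ^+ e).
    by rewrite expr_div_n -exprM mul2n -addnn exprD [lin o ^+ e.+1]exprS.
  rewrite [cof o ^+ (_ + (d - _))]exprD exprD.
  have := expf_neq0 e l0; move: (lin o ^+ e) (cof o ^+ e.+1) => w q w0.
  by field; rewrite r0 w0 l0.
apply: (subringD sA).
  apply: IH => // o'; apply: leq_trans (cl o'); exact: leq_addl.
apply: (subringM sA); first by apply: DA; apply: kD.
apply: (subringM sA); first by apply: (subringX sA); apply: gen_A.
by apply: (subringX sA); apply: DA; apply: cof_D.
Qed.

Lemma prodlin_rem o l : o \in l -> prodlin l = lin o * prodlin (rem o l).
Proof.
by move=> ol; rewrite -prodlin_cons; apply: perm_big; apply: perm_to_rem.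
Qed.

(** Common factors are cancelled; once none is left, the hypothesis on multiplicities is the bound
    on pole orders in [partial_fractions]. *)
Lemma prodlin_quotient l l' d :
  (forall o, o \in l -> on_line o) -> (forall o, o \in l' -> on_line o) ->
  size l' = (size l + d)%N ->
  (forall o, (count_mem o l <= d + count_mem o l')%N) -> A (prodlin l' / prodlin l).
Proof.
move En : (size l) => n; elim: n l l' En => [|n IH] l l' En vl vl' sl cl.
  move/size0nil: En => ->; rewrite /prodlin big_nil divr1; apply: DA.
  by apply: (@forms_D (size l')); apply: (forms_prodlin sD).
have [/hasP[o ol ol']|/hasPn h] := boolP (has (mem l') l); last first.
  apply: (@partial_fractions l d) => // [o|].
    have [ol|/count_memPn-> //] := boolP (o \in l).
    by have := cl o; rewrite (count_memPn (h o ol)) addn0.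
  by rewrite En -sl; apply: (forms_prodlin sk).
have {}ol' : o \in l' by []; have l0 := lin_neq0 (vl _ ol).
have -> : prodlin l' / prodlin l = prodlin (rem o l') / prodlin (rem o l).
  have r0 : prodlin (rem o l) != 0 by apply: prodlin_neq0 => o' /mem_rem/vl.
  by rewrite (prodlin_rem ol) (prodlin_rem ol'); field; rewrite r0 l0.
apply: IH.
- by rewrite size_rem // En.
- by move=> o' /mem_rem/vl.
- by move=> o' /mem_rem/vl'.
- by rewrite size_rem // sl.
move=> o'; have := cl o'; rewrite !count_rem ol ol'.
(* The factor [o] occurs in [l'], so the subtraction of natural numbers in [count_rem] is not
   truncated. *)
have : (pred1 o' o -> 0 < count_mem o' l')%N by move=> /eqP<-; rewrite -has_count has_pred1.
by case: (pred1 o' o) => /=; lia.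
Qed.

(** Each linear factor uses up two degrees: f = lin u + cof (lin u' + cof v') gives f / lin = u +
    cof u' + (cof^2 / lin) v'. *)
Lemma forms_div_prodlin l j f : (forall o, o \in l -> on_line o) ->
  forms D (2 * size l + j) f -> A (f / prodlin l).
Proof.
elim: l f => [|o l IH] f vl Df.
  by rewrite /prodlin big_nil divr1; apply: DA; apply: forms_D Df.
have vo : on_line o by apply: vl; rewrite mem_head.
have vl' o' : o' \in l -> on_line o' by move=> h; apply: vl; rewrite inE h orbT.
move: Df; have -> : (2 * size (o :: l) + j = (2 * size l + j).+2)%N by rewrite /=; lia.
move=> /(forms_split sD kD vo)[u [v [Du Dv Ef]]].
have [u' [v' [Du' Dv' Ev]]] := forms_split sD kD vo Dv.
have l0 := lin_neq0 vo; have p0 := prodlin_neq0 vl'.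
have -> : f / prodlin (o :: l) =
    (u + cof o * u') / prodlin l + cof o ^+ 2 / lin o * (v' / prodlin l).
  by rewrite Ef Ev prodlin_cons; field; rewrite p0 l0.
apply: (subringD sA).
  by apply: IH => //; apply: forms_weaken; apply: (formsD sD) => //; apply: (forms_cof sD).
by apply: (subringM sA); [apply: gen_A | apply: IH].
Qed.

(** * Factorization of forms over k *)

Lemma form_polyP n f : forms k n f <->
  exists p : {poly F}, [/\ poly_in k p, (size p <= n.+1)%N & f = y ^+ n * p.[x / y]].
Proof.
have y0 : y != 0 := lin_neq0 (o := None) I.
elim: n f => [|n IH] f; split.
- move=> kf; exists f%:P; split; last by rewrite hornerC mul1r.
    by move=> i; rewrite coefC; case: eqP.
  exact: size_polyC_leq1.
- by move=> [p [kp /size1_polyC-> ->]]; rewrite hornerC mul1r; apply: kp.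
- move=> [u [v [/IH[p [kp sp ->]] /IH[q [kq sq ->]] ->]]].
  exists (p * 'X + q); split.
  + by move=> i; rewrite coefD coefMX; apply: subringD => //; case: eqP.
  + apply: leq_trans (size_polyD _ _) _; rewrite geq_max; apply/andP; split; last exact: leqW.
    by apply: leq_trans (size_polyMleq _ _) _; rewrite size_polyX addn2.
  rewrite hornerD hornerMX exprS.
  by move: p.[_] q.[_] => a b; field.
move=> [p [kp sp ->]].
exists (y ^+ n * (drop_poly 1 p).[x / y]), (y ^+ n * p`_0); split.
- apply/IH; exists (drop_poly 1 p); split=> //; last by rewrite size_drop_poly leq_subLR.
  by move=> i; rewrite coef_drop_poly.
- apply/IH; exists (p`_0)%:P; rewrite hornerC; split=> //.
    by move=> i; rewrite coefC; case: eqP.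
  by apply: leq_trans (size_polyC_leq1 _) _.
have -> : p.[x / y] = (drop_poly 1 p).[x / y] * (x / y) + p`_0.
  rewrite -{1}(poly_take_drop 1 p) hornerD hornerM hornerXn expr1 addrC; congr (_ + _).
  rewrite -[RHS](hornerC _ (x / y)); congr (_.[_]); apply/polyP => i.
  by rewrite coef_take_poly coefC; case: i.
by rewrite exprS; move: _.[_] => a; field.
Qed.

(** After dehomogenization, a drop in degree means that y divides the form, which is the point
    [None]; otherwise a root c in k gives the factor x - c y. *)
Lemma form_linear_factor n f : forms k n.+1 f ->
  exists o f', [/\ on_line o, forms k n f' & f = lin o * f'].
Proof.
have y0 : y != 0 := lin_neq0 (o := None) I.
move=> /form_polyP[p [kp sp ->]].
have [sp'|sp'] := leqP (size p) n.+1.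
  exists None, (y ^+ n * p.[x / y]); split=> //; last by rewrite exprS /=; ring.
  by apply/form_polyP; exists p.
have [c [kc /factor_theorem[q Eq]]] := hkc kp (leq_ltn_trans (ltn0Sn n) sp').
exists (Some (- c)), (y ^+ n * q.[x / y]); split; first exact: subringN.
  apply/form_polyP; exists q; split=> //; first exact: (poly_in_div_root sk kc kp Eq).
  have [->|q0] := eqVneq q 0; first by rewrite size_poly0.
  move: sp; rewrite Eq size_Mmonic ?monicXsubC // size_XsubC addn2 /=.
  by [].
rewrite Eq hornerM hornerXsubC exprS /=.
by move: q.[_] => a; field.
Qed.

Lemma form_factorization n f : forms k n f -> f != 0 ->
  exists c l, [/\ k c, c != 0, forall o, o \in l -> on_line o, size l = n & f = c * prodlin l].
Proof.
elim: n f => [|n IH] f kf f0.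
  by exists f, [::]; split=> //; rewrite /prodlin big_nil mulr1.
have [o [f' [vo kf' Ef]]] := form_linear_factor kf.
have f'0 : f' != 0 by apply: contraNneq f0 => f'0; rewrite Ef f'0 mulr0.
have [c [l [kc c0 vl sl Ef']]] := IH f' kf' f'0.
exists c, (o :: l); split=> //; first by move=> o'; rewrite inE => /predU1P[->|/vl].
  by rewrite /= sl.
by rewrite Ef Ef' prodlin_cons; ring.
Qed.

(** * Local expansions and orders of elements of D *)

Lemma prodlin_point o l : on_line o -> (forall o', o' \in l -> on_line o') ->
  exists2 u, unit_in (alpha o) u &
    prodlin l = cof o ^+ size l * (u * tpar o ^+ count_mem o l).
Proof.
move=> vo; have sa := reg_subring (alpha_regular vo).
elim: l => [|b l IH] vl; first by exists 1; [apply: unit_in1 | rewrite /prodlin big_nil; ring].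
have vb : on_line b by apply: vl; rewrite mem_head.
have [|u Uu E] := IH; first by move=> o' o'l; apply: vl; rewrite inE o'l orbT.
rewrite prodlin_cons E /=; have [->|ne] := eqVneq b o.
  by exists u => //; rewrite (lin_t vo) add1n !exprS; ring.
have [v Uv ->] := lin_off vo vb ne; exists (v * u); first exact: (unit_inM sa).
by rewrite add0n exprS; ring.
Qed.

(** The exponent of [tpar o] is the multiplicity of the point as a zero of the initial form; this is
    the shape used by [order_le], [initial_monomial_unit] and [initial_exponent_le]. *)
Lemma form_point o n c l h : on_line o -> k c -> c != 0 ->
  (forall o', o' \in l -> on_line o') -> size l = n -> forms D n.+1 h ->
  exists u w, [/\ unit_in (alpha o) u, alpha o w,
    c * prodlin l = cof o ^+ n * (u * tpar o ^+ count_mem o l) &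
    c * prodlin l + h = cof o ^+ n * (u * tpar o ^+ count_mem o l + cof o * w)].
Proof.
move=> vo kc c0 vl sl Dh; have sa := reg_subring (alpha_regular vo).
have [u Uu ->] := prodlin_point vo vl; have [w aw ->] := forms_alpha vo Dh.
exists (c * u), w; rewrite sl exprS; split=> //; try ring.
by apply: (unit_inM sa) => //; apply: unit_k_alpha.
Qed.

(** If the initial form had degree n < m, then f would have s-order n at the point, by
    [order_le]. *)
Lemma forms_of_order o m f z : on_line o -> D f -> beta o z ->
  f = spar o ^+ m * z -> forms D m f.
Proof.
move=> vo Df bz E; suff H n : (n <= m)%N -> forms D n f by apply: H.
elim: n => // n IH nm; have Dn := IH (ltnW nm).
have [p kp Dp] := initial_form Dn.
have [p0|p0] := eqVneq p 0; first by rewrite -[f]subr0 -p0.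
have [c [l [kc c0 vl sl Ep]]] := form_factorization kp p0.
have [u [w [Uu aw _ Ef]]] := form_point vo kc c0 vl sl Dp.
have Ew : cof o ^+ n * (u * tpar o ^+ count_mem o l + cof o * w) = spar o ^+ m * z.
  by rewrite -Ef -Ep addrC subrK.
by have := order_le (line_regular vo) Uu aw bz Ew; rewrite leqNgt nm.
Qed.

(* Successive approximation: the initial form of [f] is itself divisible enough to
   have a quotient in [A]; forms of degree at least twice that of the
   denominator need no condition. *)
Lemma quotient_in_A l f : (forall o, o \in l -> on_line o) -> forms D (size l) f ->
  (forall o, on_line o -> beta o (f / prodlin l)) -> A (f / prodlin l).
Proof.
(* Here d is the surplus degree of the numerator and m the number of steps left; at m = 0 the
   numerator has degree at least [2 * size l]. *)
move=> vl; suff H m d g : (size l <= d + m)%N -> forms D (size l + d) g ->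
    (forall o, on_line o -> beta o (g / prodlin l)) -> A (g / prodlin l).
  by move=> Df; apply: (H (size l) 0%N); rewrite ?addn0.
elim: m d g => {f}[|m IH] d f dm Df bf.
  apply: (@forms_div_prodlin l (d - size l)) => //.
  by have -> : (2 * size l + (d - size l) = size l + d)%N by lia.
have [p kp Dp] := initial_form Df.
have G0 := prodlin_neq0 vl.
have [p0|p0] := eqVneq p 0.
  apply: (IH d.+1) => //; [lia | by rewrite addnS -[f]subr0 -p0].
have [c [l' [kc c0 vl' sl' Ep]]] := form_factorization kp p0.
have Ap : A (p / prodlin l).
  rewrite Ep -mulrA; apply: (subringM sA); first by apply: DA; apply: kD.
  apply: (@prodlin_quotient l l' d) => // o.
  have [ol|/count_memPn-> //] := boolP (o \in l); have vo := vl o ol.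
  have [u [w [Uu aw _ Ef]]] := form_point vo kc c0 vl' sl' Dp.
  have [v Uv El] := prodlin_point vo vl.
  have Ew : f / prodlin l * (cof o ^+ size l * (v * tpar o ^+ count_mem o l)) =
      cof o ^+ (size l + d) * (u * tpar o ^+ count_mem o l' + cof o * w).
    by rewrite -Ef -Ep -El divfK // addrC subrK.
  exact: (initial_exponent_le (line_regular vo) (bf o vo) Uv Uu aw Ew).
have -> : f / prodlin l = (f - p) / prodlin l + p / prodlin l by rewrite mulrBl subrK.
apply: (subringD sA) => //; apply: (IH d.+1); [lia | by rewrite addnS |].
(* The part subtracted lies in A, so the remainder is still regular at every point. *)
move=> o vo; have sb := reg_subring (beta_regular vo).
by rewrite mulrBl; apply: (subringB sb); [apply: bf | apply: A_beta].
Qed.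

(** * The intersection of the local rings is contained in C *)

Lemma beta_C z : (forall o, on_line o -> beta o z) -> ringC D k x y z.
Proof.
move=> bz.
have vN : on_line None by [].
have regN := line_regular vN.
have [g [Dg Dgz] gen] : exists2 g, D g /\ D (g * z) &
    forall d, D d -> D (d * z) -> multiples D g d.
  apply: (denominators_principal regN).
  have [u [i [j [[u0 _ _] Dd Ddz]]]] := double_transform_denominator regN (bz _ vN).
  eexists; split; [exact: Dd | | exact: Ddz].
  have regb := beta_regular vN.
  rewrite !mulf_neq0 // expf_neq0 //; first exact: (reg_fst_neq0 regb).
  exact: (reg_fst_neq0 (reg_swap regb)).
(* At each point g divides a denominator that is a unit times a monomial, so g has this form too. *)
have mono o : on_line o -> exists v i j, unit_in (beta o) v /\ g = v * spar o ^+ i * tpar o ^+ j.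
  move=> vo; have [u [i [j [Uu Dd Ddz]]]] :=
    double_transform_denominator (line_regular vo) (bz _ vo).
  have [a Da E] := gen _ Dd Ddz.
  apply: (factor_of_monomial (b := a) (beta_regular vo) _ _ Uu); try exact: D_beta.
  by rewrite mulrC -E.
have [v [N [j [Uv Eg]]]] := mono _ vN.
have regb := beta_regular vN; have sb := reg_subring regb.
have [v0 bv _] := Uv.
have bvt : beta None (v * tpar None ^+ j).
  by apply: (subringM sb) => //; apply: (subringX sb); apply: (reg_snd regb).
(* N is the s-order of g at [None]; as z is regular there, g and gz both have order at least N in
   D. *)
have Dgn : forms D N g by apply: (forms_of_order vN Dg bvt); rewrite Eg; ring.
have Dfn : forms D N (g * z).
  apply: (forms_of_order vN Dgz (subringM sb bvt (bz _ vN))); rewrite Eg; ring.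
have [p kp Dp] := initial_form Dgn.
(* Otherwise g has order above N in D, so s^(N+1) divides it at [None]. *)
have p0 : p != 0.
  apply/eqP => p0; move: Dp; rewrite p0 subr0 => /(forms_alpha vN)[w aw Ew].
  apply: (@unit_power_notin _ _ _ _ regb v j (tpar None ^+ N.+1 * w)) => //.
    by apply: (subringM sb); [apply: (subringX sb); apply: (reg_snd regb) | apply: alpha_beta].
  apply: (mulfI (expf_neq0 N (reg_fst_neq0 regb))).
  have -> : spar None ^+ N * (v * tpar None ^+ j) = g by rewrite Eg; ring.
  rewrite Ew (cof_st vN) exprMn exprSr; ring.
have [c [l [kc c0 vl sl Ep]]] := form_factorization kp p0.
have G0 := prodlin_neq0 vl.
have Ug o : on_line o -> unit_in (beta o) (g / prodlin l).
  move=> vo; have [v' [i [j' [Uv' Eg']]]] := mono o vo.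
  have [u [w [Uu aw E1 E2]]] := form_point vo kc c0 vl sl Dp.
  have -> : g / prodlin l = c * (g / (c * prodlin l)) by field; rewrite G0.
  apply: (unit_inM (reg_subring (beta_regular vo))).
    by apply: (unit_in_sub (alpha_beta vo)); apply: unit_k_alpha.
  have Ew : cof o ^+ N * (u * tpar o ^+ count_mem o l + cof o * w) =
      v' * spar o ^+ i * tpar o ^+ j' by rewrite -E2 -Ep -Eg' addrC subrK.
  rewrite E1 Eg'; exact: (initial_monomial_unit (line_regular vo) Uu aw Uv' Ew).
have Ag : A (g / prodlin l).
  by apply: quotient_in_A => //; [rewrite sl | move=> o /Ug[]].
have Af : A (g * z / prodlin l).
  apply: quotient_in_A => //; first by rewrite sl.
  move=> o vo; rewrite mulrAC; apply: (subringM (reg_subring (beta_regular vo))); last exact: bz.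
  by case: (Ug o vo).
(* The denominator is a unit at [None], hence outside [mA]. *)
exists (g * z / prodlin l), (g / prodlin l); split=> //; split=> //; split.
  by move=> /(mA_nonunit vN); apply: unit_notin_nonunits; apply: Ug.
have g0 : g != 0.
  by have [] := Ug _ vN; rewrite mulf_eq0 negb_or => /andP[].
by field; rewrite G0.
Qed.

(** * Failure of the Noetherian property *)

Lemma k_infinite (L : seq F) : exists2 a, k a & a \notin L.
Proof.
(* Only the entries of L in k are kept, so that the polynomial below has coefficients in k. *)
have [M kM LM] : exists2 M : seq F, forall c, c \in M -> k c &
    forall c, k c -> c \in L -> c \in M.
  elim: L => [|b L [M kM LM]]; first by exists [::].
  have [kb|nkb] := classic (k b); [exists (b :: M) | exists M] => // c.
  - by rewrite inE => /predU1P[->|/kM].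
  - by move=> kc; rewrite !inE => /predU1P[->|/(LM c kc)->]; rewrite ?eqxx ?orbT.
  by move=> kc; rewrite inE => /predU1P[E|/(LM c kc)//]; case: nkb; rewrite -E.
(* A root of p + 1 in k avoids M, as p vanishes on M. The extra factor X keeps p nonconstant when M
   is empty. *)
pose p := ('X - 0%:P) * \prod_(c <- M) ('X - c%:P).
have kp : poly_in k p.
  have kX q c : k c -> poly_in k q -> poly_in k (('X - c%:P) * q).
    move=> kc kq i; rewrite mulrBl coefB coefXM coefCM.
    by apply: subringB => //; [case: eqP | apply: subringM].
  apply: (kX) => //.
  elim: M kM {LM p} => [|c M IH] kM.
    by rewrite big_nil => i; rewrite coef1; case: eqP.
  rewrite big_cons; apply: kX; first by apply: kM; rewrite mem_head.
  by apply: IH => d dM; apply: kM; rewrite inE dM orbT.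
have sp : size p = (size M).+2.
  by rewrite /p size_monicM ?monicXsubC ?size_prod_XsubC ?size_XsubC //
    -size_poly_eq0 size_prod_XsubC.
have [||a [ka]] := hkc (p := p + 1).
- by move=> i; rewrite coefD coef1; apply: subringD => //; case: eqP.
- by rewrite size_polyDl sp // size_poly1.
move=> /rootP pa; exists a => //; apply/negP => /(LM a ka) aM.
move: pa; rewrite hornerD hornerC hornerM.
have /rootP -> : root (\prod_(c <- M) ('X - c%:P)) a by rewrite root_prod_XsubC.
by rewrite mulr0 add0r => /eqP; rewrite oner_eq0.
Qed.

Lemma gen_almost_all z : gensA k x y z ->
  exists L : seq F, forall a, k a -> a \notin L -> multiples (alpha (Some a)) y z.
Proof.
move=> /gensAP[[b|] vb ->]; [exists [:: b] | exists [::]] => a ka aL;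
  last exact: (gen_off (o := Some a)).
apply: (gen_off (o := Some a)) => //.
by apply: contraNneq aL => -[->]; rewrite mem_head.
Qed.

Lemma A_almost_all z : A z ->
  exists L : seq F, forall a, k a -> a \notin L -> alpha (Some a) z.
Proof.
have sa a : k a -> subring (alpha (Some a)).
  by move=> ka; apply: (reg_subring (@alpha_regular (Some a) ka)).
move=> Az; pattern z; apply: Az.
- split; first by exists [::] => a ka _; apply: (subring0 (sa a ka)).
  split; first by exists [::] => a ka _; apply: (subring1 (sa a ka)).
  split=> b c [L HL] [M HM]; exists (L ++ M) => a ka; rewrite mem_cat negb_or => /andP[aL aM].
    by apply: (subringB (sa a ka)); [apply: HL | apply: HM].
  by apply: (subringM (sa a ka)); [apply: HL | apply: HM].
- by move=> d Dd; exists [::] => a ka _; apply: (@D_alpha (Some a)).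
move=> g /gen_almost_all[L HL]; exists L => a ka /(HL a ka)[w aw ->].
by apply: (subringM (sa a ka)) => //; apply: (@D_alpha (Some a)).
Qed.

Lemma mA_almost_all z : mA z ->
  exists L : seq F, forall a, k a -> a \notin L -> multiples (alpha (Some a)) y z.
Proof.
have idM a : k a -> ideal_of (alpha (Some a)) (multiples (alpha (Some a)) y).
  move=> ka; have rega := @alpha_regular (Some a) ka.
  exact: (multiples_ideal (reg_subring rega) (reg_snd rega)).
move=> mz; suff [] : A z /\ exists L : seq F,
  forall a, k a -> a \notin L -> multiples (alpha (Some a)) y z by [].
pattern z; apply: mz.
  split; first by move=> a [].
  split; first by split; [apply: (subring0 sA) | exists [::] => a ka _; apply: (ideal0 (idM a ka))].
  split=> [b c [Ab [L HL]] [Ac [M HM]]|r b Ar [Ab [L HL]]]; split.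
  - exact: (subringD sA).
  - exists (L ++ M) => a ka; rewrite mem_cat negb_or => /andP[aL aM].
    by apply: (idealD (idM a ka)); [apply: HL | apply: HM].
  - exact: (subringM sA).
  have [M HM] := A_almost_all Ar.
  exists (L ++ M) => a ka; rewrite mem_cat negb_or => /andP[aL aM].
  by apply: (idealM (idM a ka)); [apply: HM | apply: HL].
move=> g [->|[->|gg]]; split; try by [apply: DA | apply: gen_ring_inc].
- by exists [::] => a ka _; have [] := @xy_alpha (Some a) ka.
- by exists [::] => a ka _; have [] := @xy_alpha (Some a) ka.
exact: gen_almost_all.
Qed.

(** For almost all a the numerator lies in y alpha_a, and the denominator, a nonzero constant plus
    an element of y alpha_a, is a unit there. *)
Lemma nonunits_almost_all z : nonunits (ringC D k x y) z ->
  exists L : seq F, forall a, k a -> a \notin L -> multiples (alpha (Some a)) y z.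
Proof.
move=> /(nonunits_localization mA_ideal mA_maximal)[p [q [mp Aq Nq ->]]].
have [c [kc c0 mc]] := notin_mA_constant Aq Nq.
have [L HL] := mA_almost_all mp; have [M HM] := mA_almost_all mc.
exists (L ++ M) => a ka; rewrite mem_cat negb_or => /andP[aL aM].
have rega := @alpha_regular (Some a) ka; have sa := reg_subring rega.
have [w aw ->] := HL a ka aL; have [v av E] := HM a ka aM.
have [_ _ aq'] : unit_in (alpha (Some a)) q.
  rewrite -[q](subrK c) E addrC; apply: unit_in_add_nonunit; first exact: (reg_local rega).
    exact: (@unit_k_alpha (Some a)).
  have [_ idm] := reg_local rega.
  by apply: (idealM idm) => //; apply: (reg_nonunit_snd rega).
by exists (w * q^-1); [apply: (subringM sa) | ring].
Qed.

(* Finitely many generators of the maximal ideal of [C] all lie in [y alpha_a] for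
   some [a]; then so would [s = y^2 / (x + a y)] in [y beta_a = s t beta_a]. *)
Lemma C_not_noetherian : ~ noetherian (ringC D k x y).
Proof.
have [sC idN] := C_local; move=> /(_ _ idN)[l [_ gen]].
have [L HL] : exists L : seq F, forall z, z \in l ->
    forall a, k a -> a \notin L -> multiples (alpha (Some a)) y z.
  have : forall z, z \in l -> nonunits (ringC D k x y) z.
    by move=> z zl; apply/gen; apply: gen_ideal_inc.
  elim: l {gen} => [|z l IH] Nl; first by exists [::].
  have [w wl|L HL] := IH; first by apply: Nl; rewrite inE wl orbT.
  have [M HM] := nonunits_almost_all (Nl z (mem_head _ _)).
  exists (L ++ M) => w; rewrite inE => wl a ka; rewrite mem_cat negb_or => /andP[aL aM].
  by case/predU1P: wl => [->|wl]; [apply: HM | apply: HL].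
have [a ka aL] := k_infinite L.
pose o := Some a; have vo : on_line o by [].
have regb := beta_regular vo; have sb := reg_subring regb.
have by_ : beta o y by apply: (D_beta vo).
have : nonunits (ringC D k x y) (spar o).
  apply/(nonunits_localization mA_ideal mA_maximal).
  exists (spar o), 1; split; [ | exact: (subring1 sA) | exact: mA_proper | by rewrite divr1].
  by apply: gen_ideal_inc; right; right; apply/gensAP; exists o => //; rewrite spar_gen.
have idM := multiples_ideal sb by_.
move=> /gen Hs; have [_ [w bw E]] : ringC D k x y (spar o) /\ multiples (beta o) y (spar o).
  pattern (spar o); apply: Hs.
    split; first by move=> z [].
    split; first by split; [apply: (subring0 sC) | apply: (ideal0 idM)].
    split=> [b c [Cb Mb] [Cc Mc]|r b Cr [Cb Mb]]; split.
    - exact: (subringD sC).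
    - exact: (idealD idM).
    - exact: (subringM sC).
    by apply: (idealM idM) => //; apply: C_beta.
  move=> z zl; split.
    have [] : nonunits (ringC D k x y) z by apply/gen; apply: gen_ideal_inc.
    by [].
  by have [w aw ->] := HL z zl a ka aL; exists w => //; apply: (alpha_beta vo).
(* From s = w y = w s t, cancelling s makes the parameter t a unit. *)
have [_ []] := reg_nonunit_snd regb; exists w; split=> //.
apply: (mulfI (reg_fst_neq0 regb)).
by rewrite mulr1 [RHS]E mulrA -(cof_st vo) mulrC.
Qed.

End ProjectiveLine.

Theorem theorem6p17 (F : fieldType) (D k : F -> Prop) (x y : F)
  (hD : regular_local2 D)
  (hQF : quotient_field_is D)
  (hx : D x) (hy : D y)
  (hm : forall z, nonunits D z <-> gen_ideal D (fun t => t = x \/ t = y) z)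
  (hk : coefficient_field D k)
  (hkc : alg_closed_subfield k) :
  (forall z, ringC D k x y z <->
      ((forall a, k a -> beta_a D x y a z) /\ beta' D x y z))
  /\ local_ring (ringC D k x y)
  /\ ~ noetherian (ringC D k x y)
  /\ (exists Sigma : (F -> Prop) -> Prop,
        (forall alpha, Sigma alpha -> inQ D alpha) /\
        (forall z, ringC D k x y z <-> (forall alpha, Sigma alpha -> alpha z))).
Proof.
have [lD [nD [[dimD _] _]]] := hD; have [sD _] := lD.
have tgD : two_generated D x y.
  split=> // z; rewrite hm; exact: gen_ideal_pair.
(* The index type [option F] treats the rings [beta_a] and [beta'] as a single family. *)
have CP z : ringC D k x y z <-> forall o, on_line k o -> beta D x y o z.
  split=> [Cz o vo|]; first exact: (C_beta dimD tgD hk vo Cz).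
  exact: (beta_C dimD tgD hk hkc).
split; [|split; [|split]].
- move=> z; rewrite CP; split=> [bz|[bz bz'] [a|] ka].
  + split=> [a ka|]; first by rewrite -beta_Some; apply: bz.
    by rewrite -beta_None; apply: bz.
  + by rewrite beta_Some; apply: bz.
  by rewrite beta_None.
- exact: (C_local dimD tgD hk).
- exact: (C_not_noetherian dimD tgD hk hkc).
exists (fun R => exists2 o, on_line k o & R = beta D x y o); split=> [_ [o vo ->]|z].
  split; last exact: (D_beta dimD tgD hk vo).
  exact: (reg_regular_local2 (beta_regular dimD tgD hk vo)).
rewrite CP; split=> [bz _ [o vo ->]|h o vo]; first exact: bz.
by apply: h; exists o.
Qed.
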